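(* Let $\ell\in\frac12\mathbb{N}$, $\ell>0$, $\nu>0$, and let $P^{(\nu)}_n$ be the monic matrix-valued Gegenbauer polynomials and $D^{(\nu)},E^{(\nu)}$ the matrix-valued differential operators defined in the context. For every integer $n\ge0$, the polynomials $P^{(\nu)}_n$ are eigenfunctions of $D^{(\nu)}$ and $E^{(\nu)}$: $$P^{(\nu)}_nD^{(\nu)}=\Lambda_n(D^{(\nu)})P^{(\nu)}_n,\qquad\Lambda_n(D^{(\nu)})=-n(2\ell+2\nu+n)\mathrm{I}-V,$$ $$P^{(\nu)}_nE^{(\nu)}=\Lambda_n(E^{(\nu)})P^{(\nu)}_n,\qquad\Lambda_n(E^{(\nu)})=A^{(\nu)}_0+nB_1.$$
   Context: Matrices are $(2\ell+1)\times(2\ell+1)$, indexed by $\{0,1,\dots,2\ell\}$; $E_{i,j}$ are the matrix units; $(a)_0=1$, $(a)_n=a(a+1)\cdots(a+n-1)$. The Gegenbauer polynomials are $C^{(\nu)}_n(x)=\frac{(2\nu)_n}{n!}\,{}_2F_1\!\left(-n,\,n+2\nu;\,\nu+\tfrac12;\,\tfrac12(1-x)\right)$. Definition of the weight. For $x\in(-1,1)$ and $m,n\in\{0,\dots,2\ell\}$ with $n\ge m$, $$\bigl(W^{(\nu)}(x)\bigr)_{m,n}=(1-x^2)^{\nu-1/2}\sum_{t=\max(0,n+m-2\ell)}^{m}\alpha^{(\nu)}_t(m,n)\,C^{(\nu)}_{m+n-2t}(x),$$ $$\alpha^{(\nu)}_t(m,n)=(-1)^m\frac{n!\,m!\,(m+n-2t)!}{t!\,(2\nu)_{m+n-2t}\,(\nu)_{n+m-t}}\,\frac{(\nu)_{n-t}(\nu)_{m-t}}{(n-t)!\,(m-t)!}\,\frac{n+m-2t+\nu}{n+m-t+\nu}\,(2\ell-m)!\,(n-2\ell)_{m-t}\,(-2\ell-\nu)_t\,\frac{2\ell+\nu}{(2\ell)!},$$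 and $W^{(\nu)}(x)$ is extended to a symmetric matrix; it is positive definite for $x\in(-1,1)$. $P^{(\nu)}_n(x)=x^n\,\mathrm{I}+x^{n-1}P^{(\nu)}_{n,n-1}+\cdots+P^{(\nu)}_{n,0}$, with $P^{(\nu)}_{n,i}\in M_{2\ell+1}(\mathbb{C})$, are the unique monic matrix-valued polynomials satisfying $\int_{-1}^1P^{(\nu)}_n(x)W^{(\nu)}(x)\bigl(P^{(\nu)}_m(x)\bigr)^\ast dx=\delta_{n,m}H^{(\nu)}_n$ with $H^{(\nu)}_n$ positive definite. A differential operator $\frac{d^2}{dx^2}F_2+\frac{d}{dx}F_1+F_0$ with matrix-valued $F_i$ acts from the right: $P\mapsto\frac{d^2P}{dx^2}F_2+\frac{dP}{dx}F_1+PF_0$ (entrywise derivatives). The operators are $$D^{(\nu)}=\Bigl(\frac{d^2}{dx^2}\Bigr)(1-x^2)+\Bigl(\frac{d}{dx}\Bigr)\bigl(C-x(2\ell+2\nu+1)\mathrm{I}\bigr)-V,\qquad E^{(\nu)}=\Bigl(\frac{d}{dx}\Bigr)(xB_1+B_0)+A_0^{(\nu)},$$ where $C=\sum_{i=0}^{2\ell-1}(2\ell-i)E_{i,i+1}+\sum_{i=1}^{2\ell}iE_{i,i-1}$, $V=-\sum_{i=0}^{2\ell}i(2\ell-i)E_{i,i}$, $2\ell B_0=\sum_{i=0}^{2\ell-1}(2\ell-i)E_{i,i+1}-\sum_{i=1}^{2\ell}iE_{i,i-1}$, $\ell B_1=-\sum_{i=0}^{2\ell}(\ell-i)E_{i,i}$,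 $\ell A_0^{(\nu)}=\sum_{i=0}^{2\ell}\bigl((\ell+1)(i-2\ell)-(\nu-1)(\ell-i)\bigr)E_{i,i}$. *)

(* Defs.v *)
From HB Require Import structures.
From mathcomp Require Import all_boot all_order all_algebra.
From mathcomp Require Import spectral sesquilinear complex.
From mathcomp Require Import all_classical all_reals all_analysis.
Set Implicit Arguments.
Unset Strict Implicit.
Unset Printing Implicit Defensive.
Import Order.TTheory GRing.Theory Num.Theory.
Local Open Scope ring_scope.
Local Open Scope complex_scope.
Local Open Scope sesquilinear_scope.

(* Throughout, the natural number N stands for 2l, so l = N / 2, and matrices
   of size 2l + 1 are square matrices of size N.+1.  Matrix-valued polynomials
   are elements of {poly 'M_N.+1}: the indeterminate is central, and
   evaluation at the scalar x is p.[x%:M]. *)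

Section Scalars.
Variable F : numFieldType.
Implicit Types (a b c z x nu : F) (n : nat).

Definition ell (N : nat) : F := N%:R / 2.

Definition poch a n : F := \prod_(k < n) (a + k%:R).

(* 2F1(-n, b; c; z): the series terminates because (-n)_k = 0 for k > n. *)
Definition hyp2F1_neg n b c z : F :=
  \sum_(k < n.+1) poch (- n%:R) k * poch b k / (poch c k * k`!%:R) * z ^+ k.

Definition gegenbauer nu n x : F :=
  poch (2 * nu) n / n`!%:R
  * hyp2F1_neg n (n%:R + 2 * nu) (nu + 1 / 2) ((1 - x) / 2).

End Scalars.

Section Weight.
Variable R : realType.

(* Only used for t <= m <= n <= N and n + m - N <= t, where no subtraction of
   natural numbers is truncated. *)
Definition alpha (N : nat) (nu : R) (t m n : nat) : R :=
  (-1) ^+ m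
  * (n`!%:R * m`!%:R * (m + n - 2 * t)`!%:R
     / (t`!%:R * poch (2 * nu) (m + n - 2 * t) * poch nu (n + m - t)))
  * (poch nu (n - t) * poch nu (m - t) / ((n - t)`!%:R * (m - t)`!%:R))
  * (((n + m - 2 * t)%:R + nu) / ((n + m - t)%:R + nu))
  * (N - m)`!%:R
  * poch (n%:R - N%:R) (m - t)
  * poch (- N%:R - nu) t
  * ((N%:R + nu) / N`!%:R).

(* The entry (m, n) of the weight for m <= n; the truncated subtraction
   n + m - N is max(0, n + m - 2l). *)
Definition weight_upper (N : nat) (nu x : R) (m n : nat) : R :=
  (1 - x ^+ 2) `^ (nu - 1 / 2)
  * \sum_(n + m - N <= t < m.+1)
      alpha N nu t m n * gegenbauer nu (m + n - 2 * t) x.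

(* Meaningful for -1 < x < 1 only. *)
Definition weight (N : nat) (nu x : R) : 'M[R]_N.+1 :=
  \matrix_(i, j) weight_upper N nu x (minn i j) (maxn i j).

End Weight.

Section Orthogonality.
Variable R : realType.

Definition posdefmx n (A : 'M[R[i]]_n) : Prop :=
  A ^t* = A /\
  forall v : 'rV[R[i]]_n, v != 0 -> 0 < (v *m A *m v ^t*) ord0 ord0.

Definition integralC (D : set R) (f : R -> R[i]) : R[i] :=
  Rintegral lebesgue_measure D (fun x => complex.Re (f x))
  +i* Rintegral lebesgue_measure D (fun x => complex.Im (f x)).

Definition integral_mx (D : set R) m n (f : R -> 'M[R[i]]_(m, n)) :
    'M[R[i]]_(m, n) :=
  \matrix_(i, j) integralC D (fun x => f x i j).

Definition mxpairing (N : nat) (nu : R) (p q : {poly 'M[R[i]]_N.+1}) :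
    'M[R[i]]_N.+1 :=
  integral_mx `]-1, 1[%classic
    (fun x => p.[(x%:C)%:M] *m map_mx (real_complex R) (weight N nu x)
              *m q.[(x%:C)%:M] ^t*).

(* P is the sequence of monic matrix-valued Gegenbauer polynomials: these
   conditions determine P uniquely. *)
Definition monic_mv_gegenbauer (N : nat) (nu : R)
    (P : nat -> {poly 'M[R[i]]_N.+1}) : Prop :=
  (forall n, size (P n) = n.+1 /\ P n \is monic) /\
  exists H : nat -> 'M[R[i]]_N.+1,
    (forall n, posdefmx (H n)) /\
    (forall n m, mxpairing nu (P n) (P m) = if n == m then H n else 0).

End Orthogonality.

Section Operators.
Variables (F : numFieldType) (N : nat).

(* (d/dx)^2 F2 + (d/dx) F1 + F0, with polynomial coefficients. *)
Record diffop := DiffOp {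
  dcoef2 : {poly 'M[F]_N.+1};
  dcoef1 : {poly 'M[F]_N.+1};
  dcoef0 : {poly 'M[F]_N.+1}
}.

Definition ract (p : {poly 'M[F]_N.+1}) (D : diffop) : {poly 'M[F]_N.+1} :=
  p^`(2) * dcoef2 D + p^`() * dcoef1 D + p * dcoef0 D.

Local Notation E i j := (delta_mx (inord i) (inord j) : 'M[F]_N.+1).

Definition matC : 'M[F]_N.+1 :=
  \sum_(0 <= i < N) (N%:R - i%:R) *: E i i.+1
  + \sum_(1 <= i < N.+1) i%:R *: E i i.-1.

Definition matV : 'M[F]_N.+1 :=
  - \sum_(0 <= i < N.+1) (i%:R * (N%:R - i%:R)) *: E i i.

Definition matB0 : 'M[F]_N.+1 :=
  N%:R^-1 *: (\sum_(0 <= i < N) (N%:R - i%:R) *: E i i.+1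
              - \sum_(1 <= i < N.+1) i%:R *: E i i.-1).

Definition matB1 : 'M[F]_N.+1 :=
  (ell F N)^-1 *: (- \sum_(0 <= i < N.+1) (ell F N - i%:R) *: E i i).

Definition matA0 (nu : F) : 'M[F]_N.+1 :=
  (ell F N)^-1 *:
    \sum_(0 <= i < N.+1)
      ((ell F N + 1) * (i%:R - N%:R) - (nu - 1) * (ell F N - i%:R)) *: E i i.

Definition opD (nu : F) : diffop :=
  DiffOp (1 - 'X ^+ 2)
         (matC%:P - 'X * ((N%:R + 2 * nu + 1)%:M)%:P)
         (- matV%:P).

Definition opE (nu : F) : diffop :=
  DiffOp 0 ('X * matB1%:P + matB0%:P) (matA0 nu)%:P.

Definition LambdaD (nu : F) (n : nat) : 'M[F]_N.+1 :=
  (- (n%:R * (N%:R + 2 * nu + n%:R)))%:M - matV.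

Definition LambdaE (nu : F) (n : nat) : 'M[F]_N.+1 :=
  matA0 nu + n%:R *: matB1.

End Operators.

Arguments opD {F} N nu.
Arguments opE {F} N nu.
Arguments LambdaD {F} N nu n.
Arguments LambdaE {F} N nu n.

(* Main.v *)
Require Import Defs.
From mathcomp Require Import all_boot all_order all_algebra.
From mathcomp Require Import sesquilinear complex.
From mathcomp Require Import all_classical all_reals all_analysis.
From mathcomp Require Import measurable_realfun zify ring lra.
Set Implicit Arguments.
Unset Strict Implicit.
Unset Printing Implicit Defensive.
Import Order.TTheory GRing.Theory Num.Theory.
Local Open Scope ring_scope.
Local Open Scope complex_scope.

(* Write W(x) = w(x) Wp(x) with w(x) = (1 - x^2)^(nu - 1/2) and Wp a matrix of
   polynomials. The operators D and E do not raise degrees and are symmetric for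
   the pairing (P, Q) |-> int P W Q^*, so P_n D - Lambda_n P_n, which has degree
   < n, is orthogonal to every polynomial of degree < n and hence vanishes.

   On monomials, symmetry amounts to recurrences between the moment matrices
   int x^k W(x) dx. They follow from
     int ((1 - x^2) f' - (2 nu + 1) x f) w dx = 0   for every polynomial f,
   together with identities between the entries of Wp: up to a multiple of
   m! n! (N-m)! (N-n)!, the entry (m, n) is
     sum_t rho(a) rho(b) sigma(t) sigma(d) (a + b + nu) e_(a+b),
   where n = a + t, m = b + t, N = a + b + t + d, the e_k are the Gegenbauer
   polynomials normalized by e_k(1) = 1, and rho, sigma are coefficients of
   binomial series. Comparing coefficients of e_k, each identity reduces to the
   first-order recurrences satisfied by rho and sigma. *)

(** * Integration against the Gegenbauer weight *)

(** With k = i + j, twice the symmetry relation of D on x^i and x^j is (i - j) times [moment_add] at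
    k - 1 plus [moment_sub] at k. That of E is [moment_half] at k, once [moment_skew] has moved B1
    and B0 to the left of the moments. Before integration, [moment_add] and [moment_skew] are
    identities between the entries of Wp and their derivatives. In [moment_sub] and [moment_half]
    the factor k stands in front of combinations of neighbouring entries, and W itself occurs
    without it, so W has to be integrated. Off the diagonal every e_z that occurs has z > 0, and the
    Gegenbauer equation makes (1 - x^2)^(nu + 1/2) e_z' a constant multiple of a primitive of w e_z.
    Summing these primitives gives [wser_prim], and (1 - x^2) [wser_prim] is again tied to the
    neighbouring entries. On the diagonal e_0 obstructs this, but there the factor n - m coming from
    the commutators of M with V and A0 vanishes. For nu < 1/2 the weight is unbounded at the
    endpoints, so integrals over the open interval are obtained as limits. *)

Section Analysis.
Import numFieldNormedType.Exports.
Local Open Scope sesquilinear_scope.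
Local Open Scope classical_set_scope.

(** The integrand may blow up at both endpoints: the closed-interval theorem is applied on an
    increasing exhaustion of ]a, b[, and nonnegativity allows monotone convergence. *)
Lemma ge0_integral_oo_FTC2 (R : realType) (f F : R -> R) (a b la lb : R) :
  a < b ->
  (forall x, x \in `]a, b[%R -> 0 <= f x) ->
  {in `]a, b[%R, continuous f} ->
  (forall x, x \in `]a, b[%R -> is_derive x (1 : R) F (f x)) ->
  F x @[x --> a^'+] --> la -> F x @[x --> b^'-] --> lb ->
  (\int[lebesgue_measure]_(x in `]a, b[) (f x)%:E = (lb - la)%:E)%E.
Proof.
move=> ab f0 cf dF /cvg_at_rightP Fa /cvg_at_leftP Fb.
(* The offset 2 keeps [e n] at most (b - a) / 4, so that every interval [A n] is nondegenerate. *)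
pose e n : R := (b - a) / 2 * n.+2%:R^-1.
have d0 : 0 < (b - a) / 2 by rewrite divr_gt0// subr_gt0.
have e0 n : 0 < e n by rewrite mulr_gt0// invr_gt0.
have eS n : e n <= (b - a) / 2 / 2.
  by rewrite /e ler_pM2l// lef_pV2 ?posrE// ler_nat.
have einc n m : (n <= m)%N -> e m <= e n.
  by move=> nm; rewrite /e ler_pM2l// lef_pV2 ?posrE// ler_nat !ltnS.
have ecvg : e n @[n --> \oo] --> (0 : R).
  rewrite -(mulr0 ((b - a) / 2)); apply: cvgM; first exact: cvg_cst.
  by have := @cvg_harmonic R; rewrite -cvg_shiftS.
pose A n := `[a + e n, b - e n]%classic.
have AE : \bigcup_n A n = `]a, b[%classic.
  apply/seteqP; split=> x /=.
    case=> n _; rewrite /A /= !in_itv/= => /andP[h1 h2].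
    by have := e0 n => h3; apply/andP; split; lra.
  rewrite in_itv/= => /andP[ax xb].
  have m0 : 0 < Num.min (x - a) (b - x) by rewrite lt_min !subr_gt0 ax.
  have : \forall n \near \oo, e n < Num.min (x - a) (b - x).
    by apply: cvgr_lt ecvg _ m0.
  case=> n _ /(_ n (leqnn n)); rewrite lt_min => /andP[h1 h2].
  by exists n => //; rewrite /A /= in_itv/=; apply/andP; split; lra.
have sub n x : a + e n <= x <= b - e n -> x \in `]a, b[%R.
  by move=> /andP[h1 h2]; rewrite in_itv/=; have := e0 n => h3; apply/andP; split; lra.
have mf : measurable_fun `]a, b[ f.
  by apply: open_continuous_measurable_fun => //; move=> x; rewrite inE => /cf.
have I n : (\int[lebesgue_measure]_(x in A n) (f x)%:E =
   (F (b - e n) - F (a + e n))%:E)%E.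
  have en := eS n.
  rewrite EFinB; apply: continuous_FTC2.
  - lra.
  - apply: continuous_in_subspaceT => x; rewrite inE /= in_itv/= => /sub; exact: cf.
  - have dF' x : x \in `]a, b[%R -> {for x, continuous F}.
      move=> /dF ?; apply/differentiable_continuous/derivable1_diffP; exact: ex_derive.
    split.
    + move=> x; rewrite in_itv/= => /andP[h1 h2].
      have xab : x \in `]a, b[%R by apply: (sub n); rewrite !ltW.
      have := dF _ xab => ?; exact: ex_derive.
    + apply: cvg_at_right_filter; apply: dF'; apply: (sub n).
      by rewrite lexx/=; lra.
    + apply: cvg_at_left_filter; apply: dF'; apply: (sub n).
      by rewrite lexx andbT; lra.
  - move=> x; rewrite in_itv/= => /andP[h1 h2].
    have xab : x \in `]a, b[%R by apply: (sub n); rewrite !ltW.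
    have := dF _ xab => ?; rewrite derive1E; exact: derive_val.
have c1 : (\int[lebesgue_measure]_(x in A n) (f x)%:E)%E @[n --> \oo]
     --> (\int[lebesgue_measure]_(x in `]a, b[) (f x)%:E)%E.
  rewrite -AE; apply: ge0_nondecreasing_set_cvg_integral.
  - move=> n m nm; apply/subsetPset => x; rewrite /A /= !in_itv/= => /andP[h1 h2].
    by have := einc _ _ nm => h3; apply/andP; split; lra.
  - by move=> n; exact: measurable_itv.
  - move=> n; apply/measurable_EFinP; apply: measurable_funS mf => // x.
    by rewrite /A /= in_itv/= => /sub.
  - by move=> n x; rewrite /A /= in_itv/= lee_fin => /sub /f0.
have c2 : (\int[lebesgue_measure]_(x in A n) (f x)%:E)%E @[n --> \oo]
     --> (lb - la)%:E.
  under eq_cvg do rewrite I.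
  apply: cvg_EFin; first exact: nearW.
  apply: cvgB.
    apply: Fb; split; first by move=> n; rewrite ltrBlDr ltrDl.
    by rewrite -[X in _ --> X]subr0; apply: cvgB => //; exact: cvg_cst.
  apply: Fa; split; first by move=> n; rewrite ltrDl.
  by rewrite -[X in _ --> X]addr0; apply: cvgD => //; exact: cvg_cst.
exact: (cvg_unique (@ereal_hausdorff R) c1 c2).
Qed.

Lemma continuous_powRl (R : realType) (a b : R) :
  0 < a -> {for a, continuous (fun x : R => x `^ b)}.
Proof.
move=> a0; have := is_derive1_powR b a0 => ?.
apply/differentiable_continuous/derivable1_diffP; exact: ex_derive.
Qed.

Lemma is_derive_powR_comp (R : realType) (h : R -> R) (r x d : R) : 0 < h x ->
  is_derive x (1 : R) h d ->
  is_derive x (1 : R) (fun y => h y `^ r) (d * (r * h x `^ (r - 1))).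
Proof.
move=> h0 dh; have d1 := is_derive1_powR r h0.
rewrite [_ * _]mulrC; exact: is_derive1_comp.
Qed.

Lemma cvg_powR_comp0 (R : realType) (T : Type) (F : set_system T) (h : T -> R) (r : R) :
  Filter F -> 0 < r -> (\forall x \near F, 0 < h x) -> h x @[x --> F] --> (0 : R) ->
  h x `^ r @[x --> F] --> (0 : R).
Proof.
move=> FF r0 hpos h0.
apply: cvg_trans (powR_cvg0 r0) => A /= A0.
have := h0 _ A0; rewrite /= => B.
rewrite nbhs_nearE nearE /=; move: hpos B; rewrite !nbhs_nearE.
apply: filterS2 => x h1 h2; exact: h2.
Qed.

Section Weight.
Variables (R : realType) (s : R).
Hypothesis s_gt : -1 < s.

(* [g] dominates (1 - x^2)^s on ]-1, 1[ whatever the sign of s, and has the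
   explicit primitive [G], which extends continuously to [-1, 1]. *)
Let g (x : R) := (1 + x) `^ s + (1 - x) `^ s.
Let G (x : R) := (s + 1)^-1 * ((1 + x) `^ (s + 1) - (1 - x) `^ (s + 1)).

Let s1 : 0 < s + 1. Proof. by rewrite -ltrBlDr sub0r. Qed.

Let onem_pos (x : R) : x \in `]-1, 1[%R -> 0 < 1 + x /\ 0 < 1 - x.
Proof. by rewrite in_itv/= => /andP[? ?]; split; lra. Qed.

Let onem_sqr_gt0 (x : R) : x \in `]-1, 1[%R -> 0 < 1 - x ^+ 2.
Proof.
by move=> /onem_pos[h1 h2]; rewrite (_ : _ - _ = (1 + x) * (1 - x)); [exact: mulr_gt0|ring].
Qed.

Let is_derive1D (x : R) : is_derive x (1 : R) (fun y : R => 1 + y) 1.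
Proof.
by have := is_deriveD (is_derive_cst (1 : R) x 1) (is_derive_id x (1 : R)); rewrite add0r.
Qed.

Let is_derive1B (x : R) : is_derive x (1 : R) (fun y : R => 1 - y) (- 1).
Proof.
by have := is_deriveB (is_derive_cst (1 : R) x 1) (is_derive_id x (1 : R)); rewrite sub0r.
Qed.

Let dG (x : R) : x \in `]-1, 1[%R -> is_derive x (1 : R) G (g x).
Proof.
move=> /onem_pos[h1 h2].
have d1 := @is_derive_powR_comp R (fun y => 1 + y) (s + 1) x _ h1 (is_derive1D x).
have d2 := @is_derive_powR_comp R (fun y => 1 - y) (s + 1) x _ h2 (is_derive1B x).
have := is_deriveZ (s + 1)^-1 (is_deriveB d1 d2).
rewrite !addrK !mul1r /g /GRing.scale/=.
rewrite [X in is_derive _ _ _ X -> _](_ : _ = g x)//.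
by rewrite /GRing.scale/= /g; field; rewrite gt_eqF.
Qed.

Let cg : {in `]-1, 1[%R, continuous g}.
Proof.
move=> x /onem_pos[h1 h2].
apply: cvgD.
  apply: (@continuous_comp _ _ _ (fun y : R => 1 + y) (fun y : R => y `^ s)).
    by apply: cvgD; [exact: cvg_cst|exact: cvg_id].
  exact: continuous_powRl.
apply: (@continuous_comp _ _ _ (fun y : R => 1 - y) (fun y : R => y `^ s)).
  by apply: cvgB; [exact: cvg_cst|exact: cvg_id].
exact: continuous_powRl.
Qed.

Let cvg1D : (1 + x : R) @[x --> (-1)^'+] --> (0 : R).
Proof.
rewrite -(subrr (1 : R)); apply: cvg_at_right_filter.
by apply: cvgD; [exact: cvg_cst|exact: cvg_id].
Qed.

Let cvg1B : (1 - x : R) @[x --> (1:R)^'-] --> (0 : R).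
Proof.
rewrite -(subrr (1 : R)); apply: cvg_at_left_filter.
by apply: cvgB; [exact: cvg_cst|exact: cvg_id].
Qed.

Let cvgGl : G x @[x --> (-1)^'+] --> (s + 1)^-1 * (0 - 2 `^ (s + 1)).
Proof.
apply: cvgM; first exact: cvg_cst.
apply: cvgB.
  apply: cvg_powR_comp0 cvg1D => //.
  by near=> x; rewrite -ltrBlDl sub0r; near: x; exact: nbhs_right_gt.
apply: cvg_at_right_filter.
have -> : 2 `^ (s + 1) = (1 - (-1 : R)) `^ (s + 1) by congr (_ `^ _); lra.
apply: (@continuous_comp _ _ _ (fun y : R => 1 - y) (fun y : R => y `^ (s + 1))).
  by apply: cvgB; [exact: cvg_cst|exact: cvg_id].
apply: continuous_powRl; lra.
Unshelve. all: by end_near. Qed.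

Let cvgGr : G x @[x --> (1 : R)^'-] --> (s + 1)^-1 * (2 `^ (s + 1) - 0).
Proof.
apply: cvgM; first exact: cvg_cst.
apply: cvgB.
  apply: cvg_at_left_filter.
  have -> : 2 `^ (s + 1) = (1 + (1 : R)) `^ (s + 1) by congr (_ `^ _); lra.
  apply: (@continuous_comp _ _ _ (fun y : R => 1 + y) (fun y : R => y `^ (s + 1))).
    by apply: cvgD; [exact: cvg_cst|exact: cvg_id].
  apply: continuous_powRl; lra.
apply: cvg_powR_comp0 cvg1B => //.
by near=> x; rewrite subr_gt0; near: x; exact: nbhs_left_lt.
Unshelve. all: by end_near. Qed.

Definition gweight (x : R) := (1 - x ^+ 2) `^ s.

(** One of 1 + x and 1 - x is at most 1 and the other at least 1. Hence, whatever the sign of s, one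
    of the two s-th powers is at most 1, and their product is bounded by the other one. *)
Let gweight_le (x : R) : x \in `]-1, 1[%R -> 0 <= gweight x <= g x.
Proof.
move=> /onem_pos[h1 h2]; rewrite powR_ge0 /= /gweight /g.
rewrite (_ : 1 - x ^+ 2 = (1 + x) * (1 - x)); last by ring.
rewrite (powRM _ (ltW h1) (ltW h2)).
have p1 := powR_gt0 s h1; have p2 := powR_gt0 s h2.
suff : (1 + x) `^ s <= 1 \/ (1 - x) `^ s <= 1.
  case=> h; [apply: (@le_trans _ _ ((1 - x) `^ s))|apply: (@le_trans _ _ ((1 + x) `^ s))].
  - by rewrite ger_pMl.
  - by rewrite lerDr ltW.
  - by rewrite ger_pMr.
  - by rewrite lerDl ltW.
have mono (y z : R) : 1 <= y -> 0 < z -> z <= 1 -> y `^ s <= 1 \/ z `^ s <= 1.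
  move=> y1 z0 z1; case: (leP 0 s) => s0; [right|left].
    have := @ge0_ler_powR R s s0 z 1; rewrite powR1 !nnegrE; apply => //; exact: ltW.
  have y0 : 0 < y by exact: lt_le_trans y1.
  have s0' : 0 <= - s by rewrite oppr_ge0 ltW.
  rewrite -(opprK s) powRN invf_le1 ?powR_gt0//.
  by have := @ge0_ler_powR R (- s) s0' 1 y; rewrite powR1 !nnegrE; apply => //; exact: ltW.
case: (leP 0 x) => x0; first by apply: mono => //; lra.
by have [] : (1 - x) `^ s <= 1 \/ (1 + x) `^ s <= 1; [apply: mono => //; lra|right|left].
Qed.

Let mg : measurable_fun `](-1 : R), 1[ g.
Proof.
by apply: open_continuous_measurable_fun => //; move=> x; rewrite inE => /cg.
Qed.

Let g_ge0 (x : R) : x \in `]-1, 1[%R -> 0 <= g x.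
Proof. by move=> _; rewrite addr_ge0// powR_ge0. Qed.

Let lt11 : (-1 : R) < 1. Proof. lra. Qed.

Let int_g : lebesgue_measure.-integrable `](-1 : R), 1[ (EFin \o g).
Proof.
apply/integrableP; split; first exact/measurable_EFinP.
under eq_integral => x _.
  rewrite /= ger0_norm; last by rewrite addr_ge0// powR_ge0.
  over.
by rewrite (ge0_integral_oo_FTC2 lt11 g_ge0 cg dG cvgGl cvgGr) ltry.
Qed.

Let derive_gweight (x : R) : x \in `]-1, 1[%R ->
  is_derive x (1 : R) (fun y : R => (1 - y ^+ 2) `^ (s + 1)) (- (2 * (s + 1) * x) * gweight x).
Proof.
move=> /onem_sqr_gt0 h.
have := is_derive_poly (1 - 'X^2 : {poly R}) x.
rewrite (_ : horner _ = fun y : R => 1 - y ^+ 2); last first.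
  by apply/funext => y; rewrite !hornerE.
move=> d.
have := @is_derive_powR_comp R (fun y => 1 - y ^+ 2) (s + 1) x _ h d.
rewrite addrK /gweight.
rewrite [X in is_derive _ _ _ X -> _](_ : _ = - (2 * (s + 1) * x) * (1 - x ^+ 2) `^ s)//.
by rewrite !poly.derivE !hornerE /=; ring.
Qed.

Let cgweight : {in `]-1, 1[%R, continuous gweight}.
Proof.
move=> x /onem_sqr_gt0 h.
apply: (@continuous_comp _ _ _ (fun y : R => 1 - y ^+ 2) (fun y : R => y `^ s)).
  by apply: cvgB; [exact: cvg_cst|exact: exprn_continuous].
exact: continuous_powRl.
Qed.

Lemma bounded_poly (p : {poly R}) :
  exists2 K : R, 0 <= K & forall x : R, x \in `]-1, 1[%R -> `|p.[x]| <= K.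
Proof.
exists (\sum_(i < size p) `|p`_i|); first by rewrite sumr_ge0.
move=> x; rewrite in_itv/= => /andP[x1 x2].
have h : `|x| <= 1 by rewrite ler_norml !ltW.
rewrite horner_coef (le_trans (ler_norm_sum _ _ _))// ler_sum// => i _.
rewrite normrM normrX -[leRHS]mulr1 ler_wpM2l//.
exact: exprn_ile1.
Qed.

Lemma integrable_poly_gweight (p : {poly R}) :
  lebesgue_measure.-integrable `](-1 : R), 1[ (EFin \o (fun x => p.[x] * gweight x)).
Proof.
have [K K0 hK] := bounded_poly p.
have Ig : lebesgue_measure.-integrable `](-1 : R), 1[ (EFin \o (fun x => K * g x)).
  by apply: (@integrableZl _ _ _ _ _ _ K _ int_g).
apply: (le_integrable _ _ _ Ig) => //.
  apply/measurable_EFinP.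
  apply: open_continuous_measurable_fun => //; move=> x; rewrite inE => xI.
  by apply: cvgM; [exact: continuous_horner|exact: cgweight].
move=> x xI /=; rewrite lee_fin.
have /andP[h1 h2] := gweight_le xI.
rewrite !normrM !(ger0_norm h1) (ger0_norm K0) (ger0_norm (g_ge0 xI)).
by rewrite ler_pM//; exact: hK.
Qed.

(** The integrand is the derivative of p (1 - x^2)^(s + 1), which tends to 0 at both endpoints
    because s + 1 > 0. *)
Lemma integral_gweight_pearson (p : {poly R}) :
  \int[lebesgue_measure]_(x in `](-1 : R), 1[)
     (((1 - 'X^2) * p^`() - (2 * (s + 1)) *: ('X * p)).[x] * gweight x) = 0.
Proof.
pose q := (1 - 'X^2) * p^`() - (2 * (s + 1)) *: ('X * p); rewrite -/q.
have [K K0 hK] := bounded_poly q.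
pose f x := q.[x] * gweight x.
pose F (x : R) := p.[x] * (1 - x ^+ 2) `^ (s + 1).
have cf : {in `]-1, 1[%R, continuous f}.
  by move=> x xI; apply: cvgM; [exact: continuous_horner|exact: cgweight].
have dF (x : R) : x \in `]-1, 1[%R -> is_derive x (1 : R) F (f x).
  move=> xI; have := is_deriveM (is_derive_poly p x) (derive_gweight xI).
  rewrite [X in is_derive _ _ _ X -> _](_ : _ = f x)// /f /q /GRing.scale/=.
  have onem : (1 - x ^+ 2) `^ (s + 1) = (1 - x ^+ 2) * gweight x.
    have h := onem_sqr_gt0 xI.
    by rewrite powRD ?gt_eqF ?implybT// powRr1 ?ltW// mulrC.
  rewrite onem !hornerE /=; ring.
have cvg1X (A : set_system R) (a : R) : Filter A -> A --> a -> a ^+ 2 = 1 ->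
    (\forall x \near A, x \in `]-1, 1[%R) -> F x @[x --> A] --> (0 : R).
  move=> FA Aa a2 nA; rewrite -(mulr0 p.[a]); apply: cvgM.
    by apply: continuous_cvg => //; exact: continuous_horner.
  apply: cvg_powR_comp0 => //.
    by apply: filterS nA => x /onem_sqr_gt0.
  rewrite -(subrr (1 : R)); apply: cvgB; first exact: cvg_cst.
  by have := cvg_comp _ _ Aa (@exprn_continuous R 2 a); rewrite a2.
have Fl : F x @[x --> (-1)^'+] --> (0 : R).
  apply: (@cvg1X _ (-1)); [exact: cvg_at_right_filter|by ring|].
  near=> x; rewrite in_itv/=; apply/andP; split; near: x.
    exact: nbhs_right_gt.
  exact: nbhs_right_lt.
have Fr : F x @[x --> (1 : R)^'-] --> (0 : R).
  apply: (@cvg1X _ 1); [exact: cvg_at_left_filter|by ring|].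
  near=> x; rewrite in_itv/=; apply/andP; split; near: x.
    exact: nbhs_left_gt.
  exact: nbhs_left_lt.
(* Since |f| <= K g, the nonnegative case applies to f + K g and to K g. *)
pose H x := K * G x.
have dH (x : R) : x \in `]-1, 1[%R -> is_derive x (1 : R) H (K * g x).
  by move=> /dG d; exact: is_deriveZ.
have Hl : H x @[x --> (-1)^'+] --> K * ((s + 1)^-1 * (0 - 2 `^ (s + 1))).
  by apply: cvgM cvgGl; exact: cvg_cst.
have Hr : H x @[x --> (1 : R)^'-] --> K * ((s + 1)^-1 * (2 `^ (s + 1) - 0)).
  by apply: cvgM cvgGr; exact: cvg_cst.
have cH : {in `]-1, 1[%R, continuous (fun x => K * g x)}.
  by move=> x /cg c; apply: cvgM => //; exact: cvg_cst.
have H0 x : x \in `]-1, 1[%R -> 0 <= K * g x by move=> /g_ge0; exact: mulr_ge0.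
have I1 := ge0_integral_oo_FTC2 lt11 H0 cH dH Hl Hr.
have FH0 x : x \in `]-1, 1[%R -> 0 <= f x + K * g x.
  move=> xI; have /andP[j0 jg] := gweight_le xI.
  have : `|f x| <= K * g x by rewrite /f normrM (ger0_norm j0) ler_pM//; exact: hK.
  by rewrite ler_norml => /andP[fK _]; rewrite -lerBlDr sub0r.
have cFH : {in `]-1, 1[%R, continuous (fun x => f x + K * g x)}.
  by move=> x xI; apply: cvgD; [exact: cf|exact: cH].
have dFH (x : R) : x \in `]-1, 1[%R -> is_derive x (1 : R) (F \+ H) (f x + K * g x).
  by move=> xI; apply: is_deriveD; [exact: dF|exact: dH].
have I2 := ge0_integral_oo_FTC2 lt11 FH0 cFH dFH (cvgD Fl Hl) (cvgD Fr Hr).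
have If : lebesgue_measure.-integrable `](-1 : R), 1[ (EFin \o f) by exact: integrable_poly_gweight.
have Ig : lebesgue_measure.-integrable `](-1 : R), 1[ (EFin \o (fun x => K * g x)).
  by apply: (@integrableZl _ _ _ _ _ _ K _ int_g).
move: I2; under eq_integral do rewrite EFinD.
rewrite integralD_EFin// I1 !add0r => /(_ _ _) e.
rewrite /Rintegral.
have fin := integrable_fin_num _ If.
move: e; rewrite /= -[X in (X + _)%E]fineK ?fin// -EFinD => -[].
by move=> /eqP; rewrite -[X in _ == X]add0r (inj_eq (addIr _)) => /eqP.
Unshelve. all: by end_near. Qed.

End Weight.

(** * Integrals of complex-valued and matrix-valued functions *)

Section IntegralC.
Variables (R : realType) (D : set R).
Hypothesis mD : measurable (D : set (measurableTypeR R)).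
Local Notation mu := lebesgue_measure.

(** Integrability is bundled with the value: [integralC] has a value for every function, but it is
    linear only on integrable ones. *)
Definition has_integralC (f : R -> R[i]) (v : R[i]) :=
  [/\ mu.-integrable D (EFin \o (fun x => complex.Re (f x))),
      mu.-integrable D (EFin \o (fun x => complex.Im (f x))) & integralC D f = v].

Lemma has_integralC_eq f g v : f =1 g -> has_integralC f v -> has_integralC g v.
Proof. by move=> /funext ->. Qed.

Lemma has_integralC_real (g : R -> R) : mu.-integrable D (EFin \o g) ->
  has_integralC (fun x => (g x)%:C) (\int[mu]_(x in D) g x)%:C.
Proof.
move=> ig; split => //=; first exact: integrable0.
by rewrite /integralC /= Rintegral_cst// mul0r.
Qed.

Lemma has_integralCD f g u v : has_integralC f u -> has_integralC g v ->
  has_integralC (fun x => f x + g x) (u + v).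
Proof.
move=> [f1 f2 <-] [g1 g2 <-].
have e1 x : complex.Re (f x + g x) = complex.Re (f x) + complex.Re (g x) by rewrite raddfD.
have e2 x : complex.Im (f x + g x) = complex.Im (f x) + complex.Im (g x) by rewrite raddfD.
split.
- by rewrite (funext e1); exact: (integrableD mD f1 g1).
- by rewrite (funext e2); exact: (integrableD mD f2 g2).
- by rewrite /integralC (funext e1) (funext e2) !RintegralD.
Qed.

Lemma has_integralCZ (c : R[i]) f u : has_integralC f u ->
  has_integralC (fun x => c * f x) (c * u).
Proof.
move: c => [a b] [f1 f2 <-].
have e1 x : complex.Re ((a +i* b) * f x) = a * complex.Re (f x) - b * complex.Im (f x).
  by case: (f x).
have e2 x : complex.Im ((a +i* b) * f x) = a * complex.Im (f x) + b * complex.Re (f x).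
  by case: (f x).
have Z (r : R) h : mu.-integrable D (EFin \o h) -> mu.-integrable D (EFin \o (fun x => r * h x)).
  by move=> hh; apply: (@integrableZl _ _ _ _ _ _ r _ hh).
split.
- by rewrite (funext e1); exact: (integrableB mD (Z a _ f1) (Z b _ f2)).
- by rewrite (funext e2); exact: (integrableD mD (Z a _ f2) (Z b _ f1)).
- rewrite /integralC (funext e1) (funext e2) RintegralB ?RintegralD ?RintegralZl//; exact: Z.
Qed.

Lemma has_integralC_sum (I : Type) (r : seq I) (f : I -> R -> R[i]) (u : I -> R[i]) :
  (forall i, has_integralC (f i) (u i)) ->
  has_integralC (fun x => \sum_(i <- r) f i x) (\sum_(i <- r) u i).
Proof.
move=> h; elim: r => [|i r IH].
  rewrite big_nil; have := has_integralC_real (integrable0 mu D).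
  rewrite Rintegral_cst// mul0r => hh.
  by apply: has_integralC_eq hh => x; rewrite big_nil.
rewrite big_cons; apply: has_integralC_eq (has_integralCD (h i) IH) => x.
by rewrite big_cons.
Qed.

Definition has_integral_mx m n (F : R -> 'M[R[i]]_(m, n)) (A : 'M[R[i]]_(m, n)) :=
  forall i j, has_integralC (fun x => F x i j) (A i j).

Lemma has_integral_mxE m n (F : R -> 'M[R[i]]_(m, n)) A :
  has_integral_mx F A -> integral_mx D F = A.
Proof. by move=> h; apply/matrixP => i j; rewrite mxE; have [] := h i j. Qed.

Lemma has_integral_mx_sum (I : Type) (r : seq I) m n (F : I -> R -> 'M[R[i]]_(m, n)) A :
  (forall i, has_integral_mx (F i) (A i)) ->
  has_integral_mx (fun x => \sum_(i <- r) F i x) (\sum_(i <- r) A i).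
Proof.
move=> h a b; rewrite summxE.
have := has_integralC_sum r (fun i => h i a b).
by apply: has_integralC_eq => x; rewrite summxE.
Qed.

Lemma has_integral_mx_mull m n p (B : 'M[R[i]]_(p, m)) (F : R -> 'M[R[i]]_(m, n)) A :
  has_integral_mx F A -> has_integral_mx (fun x => B *m F x) (B *m A).
Proof.
move=> h a b; rewrite mxE.
have := has_integralC_sum (index_enum _) (fun k => has_integralCZ (B a k) (h k b)).
by apply: has_integralC_eq => x; rewrite mxE.
Qed.

Lemma has_integral_mx_mulr m n p (B : 'M[R[i]]_(n, p)) (F : R -> 'M[R[i]]_(m, n)) A :
  has_integral_mx F A -> has_integral_mx (fun x => F x *m B) (A *m B).
Proof.
move=> h a b; rewrite mxE.
under eq_bigr do rewrite mulrC.
have := has_integralC_sum (index_enum _) (fun k => has_integralCZ (B k b) (h a k)).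
by apply: has_integralC_eq => x; rewrite mxE; apply: eq_bigr => k _; rewrite mulrC.
Qed.

End IntegralC.

Definition gweight_int (R : realType) (s : R) (p : {poly R}) : R :=
  \int[lebesgue_measure]_(x in `](-1 : R), 1[) (p.[x] * gweight s x).

Section GweightInt.
Variables (R : realType) (s : R).
Hypothesis s_gt : -1 < s.

Lemma gweight_intD p q : gweight_int s (p + q) = gweight_int s p + gweight_int s q.
Proof.
rewrite /gweight_int -RintegralD//; try exact: integrable_poly_gweight.
by apply: eq_Rintegral => x _; rewrite hornerD mulrDl.
Qed.

Lemma gweight_intZ c p : gweight_int s (c *: p) = c * gweight_int s p.
Proof.
rewrite /gweight_int -RintegralZl//; try exact: integrable_poly_gweight.
by apply: eq_Rintegral => x _; rewrite hornerZ mulrA.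
Qed.

Lemma gweight_intN p : gweight_int s (- p) = - gweight_int s p.
Proof. by rewrite -scaleN1r gweight_intZ mulN1r. Qed.

Lemma gweight_int_pearson p :
  gweight_int s ((1 - 'X^2) * p^`() - (2 * (s + 1)) *: ('X * p)) = 0.
Proof. exact: integral_gweight_pearson. Qed.

End GweightInt.

(** * The matrix pairing expressed through moments *)

Section Pairing.
Variables (R : realType) (N : nat) (nu : R).
Hypothesis nu_gt0 : 0 < nu.
Variable Wp : 'I_N.+1 -> 'I_N.+1 -> {poly R}.
Hypothesis weightE : forall x i j,
  weight N nu x i j = (Wp i j).[x] * gweight (nu - 1 / 2) x.

Definition moment k : 'M[R]_N.+1 :=
  \matrix_(i, j) gweight_int (nu - 1 / 2) ('X^k * Wp i j).

Let s_gt : -1 < nu - 1 / 2.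
Proof. by move: nu_gt0; lra. Qed.

(** As x is real, conjugation only affects the coefficients of [q]; the powers of x multiply to x^(i
    + j), so the pairing has a block Hankel form. *)
Lemma mxpairingE (p q : {poly 'M[R[i]]_N.+1}) :
  mxpairing nu p q =
  \sum_(i < size p) \sum_(j < size q)
     p`_i *m map_mx (real_complex R) (moment (i + j)) *m (q`_j) ^t*.
Proof.
have mI : measurable (`](-1 : R), 1[ : set (measurableTypeR R)) by [].
apply: has_integral_mxE.
have hm k : has_integral_mx `](-1 : R), 1[
    (fun x => (x ^+ k)%:C *: map_mx (real_complex R) (weight N nu x))
    (map_mx (real_complex R) (moment k)).
  move=> i j; rewrite /moment !mxE.
  have := has_integralC_real mI (integrable_poly_gweight s_gt ('X^k * Wp i j)).
  apply: has_integralC_eq => x.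
  rewrite [RHS]mxE [X in _ = _ * X]mxE weightE -rmorphM /=.
  by rewrite hornerM hornerXn mulrA.
have := has_integral_mx_sum mI (index_enum _) (fun i : 'I_(size p) =>
  has_integral_mx_sum mI (index_enum _) (fun j : 'I_(size q) =>
   has_integral_mx_mulr mI (q`_j ^t*) (has_integral_mx_mull mI p`_i (hm (i + j)%N)))).
move=> h a b; have := h a b; apply: has_integralC_eq => x.
congr (fun_of_matrix _ a b).
have scalX (A : 'M[R[i]]_N.+1) k : A * (x%:C)%:M ^+ k = (x ^+ k)%:C *: A.
  by rewrite -rmorphXn /= -mulmxE mul_mx_scalar -rmorphXn.
rewrite !horner_coef; under [in RHS]eq_bigr do rewrite scalX.
under [X in _ = _ *m X ^t*]eq_bigr do rewrite scalX.
rewrite !mulmx_suml; apply: eq_bigr => i _.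
rewrite linear_sum [X in _ = _ *m X]raddf_sum /= mulmx_sumr; apply: eq_bigr => j _.
rewrite [(_ *: q`_j)^T]linearZ /= map_mxZ.
rewrite [X in _ = _ *m (X *: _)](_ : _ = (x ^+ j)%:C); last exact: conjc_real.
rewrite -!scalemxAr -!scalemxAl scalerA.
by rewrite -rmorphM -exprD addnC.
Qed.

End Pairing.

End Analysis.

(** * Gegenbauer polynomials *)

Section Pochhammer.
Variable F : numFieldType.
Implicit Types (a : F) (n : nat).

Lemma poch0 a : poch a 0 = 1. Proof. by rewrite /poch big_ord0. Qed.

Lemma pochSr a n : poch a n.+1 = poch a n * (a + n%:R).
Proof. by rewrite /poch big_ord_recr. Qed.

Lemma pochS a n : poch a n.+1 = a * poch (a + 1) n.
Proof.
rewrite /poch big_ord_recl /= addr0; congr (_ * _).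
by apply: eq_bigr => i _; rewrite /bump /= -addrA nat1r.
Qed.

Lemma poch_gt0 a n : 0 < a -> 0 < poch a n.
Proof. by move=> a0; apply: prodr_gt0 => i _; rewrite ltr_wpDr. Qed.

Lemma poch_neg_nat k n : (k < n)%N -> poch (- k%:R : F) n = 0.
Proof. by move=> kn; rewrite /poch (bigD1 (Ordinal kn)) //= addNr mul0r. Qed.

End Pochhammer.

(** Lets [ring] or [field] prove an equation modulo a known one: it suffices that the differences of
    the two sides agree. *)
Lemma eq_by_sub (V : zmodType) (a b c d : V) : c = d -> a - b = c - d -> a = b.
Proof. by move=> -> /eqP; rewrite subrr subr_eq0 => /eqP. Qed.

Section Gegenbauer.
Variables (F : numFieldType) (nu : F).
Hypothesis nu_gt0 : 0 < nu.
Implicit Types (k j : nat).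

(* Coefficient of ((1 - x) / 2)^j in the k-th Gegenbauer polynomial, normalized
   to take the value 1 at x = 1. *)
Definition gcoef k j : F :=
  poch (- k%:R) j * poch (k%:R + 2 * nu) j / (poch (nu + 1 / 2) j * j`!%:R).

Let nu2 : 0 < nu + 1 / 2. Proof. by rewrite addr_gt0// divr_gt0. Qed.

Let D_neq0 j : nu + 1 / 2 + j%:R != 0.
Proof. by rewrite gt_eqF// ltr_wpDr. Qed.

Lemma gcoef0 k : gcoef k 0 = 1.
Proof. by rewrite /gcoef !poch0 !mul1r invr1. Qed.

Lemma gcoefS k j : j.+1%:R * (nu + 1 / 2 + j%:R) * gcoef k j.+1 =
  (j%:R - k%:R) * (k%:R + 2 * nu + j%:R) * gcoef k j.
Proof.
rewrite /gcoef !pochSr factS natrM.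
have := D_neq0 j; have := poch_gt0 j nu2; rewrite lt0r => /andP[h1 _] h2.
field.
rewrite h1 pnatr_eq0 -lt0n fact_gt0 nat1r pnatr_eq0 /=.
have -> : nu * 2 + 1 + j%:R * 2 = 2 * (nu + 1 / 2 + j%:R) by field.
by rewrite mulf_neq0 ?pnatr_eq0.
Qed.

Lemma gcoef1 k : (nu + 1 / 2) * gcoef k 1 = - k%:R * (k%:R + 2 * nu).
Proof.
by have := gcoefS k 0; rewrite gcoef0 !addr0 sub0r mulr1 !mul1r.
Qed.

Lemma gcoef_gt k j : (k < j)%N -> gcoef k j = 0.
Proof. by move=> kj; rewrite /gcoef poch_neg_nat// !mul0r. Qed.

(* Factors common to the coefficients of index k - 1, k and k + 1. *)
Let A k i := poch (1 - k%:R : F) i.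
Let B k i := poch (k%:R + 2 * nu + 1) i.
Let D i := poch (nu + 1 / 2) i.+2 * i.+2`!%:R.
Let q i := (nu + 1 / 2 + 1 + i%:R) * (2 + i%:R).

Let gcoefA k i : gcoef k i.+2 = - k%:R * (1 + i%:R - k%:R) * A k i *
   ((k%:R + 2 * nu) * B k i * (k%:R + 2 * nu + 1 + i%:R)) / D i.
Proof.
rewrite /gcoef /D; congr (_ / _).
rewrite pochS pochSr [poch (k%:R + 2 * nu) _]pochS pochSr /A /B.
rewrite (addrC (- k%:R) 1); ring.
Qed.

Let gcoefAS k i : gcoef k.+1 i.+2 = (k.+1%:R * k%:R) * A k i *
   (B k i * (k%:R + 2 * nu + 1 + i%:R) * (k%:R + 2 * nu + 2 + i%:R)) / D i.
Proof.
rewrite /gcoef /D; congr (_ / _).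
rewrite 2!pochS !pochSr /A /B.
rewrite (_ : - k.+1%:R + 1 + 1 = 1 - k%:R :> F); last by rewrite -natr1; ring.
rewrite (_ : k.+1%:R + 2 * nu = k%:R + 2 * nu + 1); last by rewrite -natr1; ring.
rewrite -!natr1; ring.
Qed.

Let gcoefAP k i : k%:R * gcoef k.-1 i.+2 =
   k%:R * (A k i * (1 + i%:R - k%:R) * (2 + i%:R - k%:R)) *
   ((k%:R + 2 * nu - 1) * (k%:R + 2 * nu) * B k i) / D i.
Proof.
case: k => [|k]; first by rewrite !mul0r.
rewrite /= /gcoef /D -!mulrA; congr (_ * _); rewrite !mulrA; congr (_ / _).
rewrite !pochSr -!pochSr 2!pochSr [in X in _ * X = _]pochS pochS /A /B.
rewrite (_ : 1 - k.+1%:R = - k%:R :> F); last by rewrite -natr1; ring.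
rewrite (_ : k%:R + 2 * nu + 1 + 1 = k.+1%:R + 2 * nu + 1); last by rewrite -natr1; ring.
rewrite -!natr1; ring.
Qed.

Let gcoefA1 k i : gcoef k i.+1 = - k%:R * A k i * ((k%:R + 2 * nu) * B k i) * q i / D i.
Proof.
rewrite /gcoef pochS [poch (k%:R + 2 * nu) _]pochS (addrC (- k%:R) 1) -/(A k i) -/(B k i).
rewrite -(mulrA _ (q i)); congr (_ * _).
rewrite /q /D [in RHS]pochSr [in RHS]factS natrM.
have := D_neq0 i.+1; have := poch_gt0 i.+1 nu2; rewrite lt0r => /andP[h1 _] h2.
have h3 : (i.+1)`!%:R != 0 :> F by rewrite pnatr_eq0 -lt0n fact_gt0.
have h4 : i.+2%:R != 0 :> F by rewrite pnatr_eq0.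
have -> : 2 + i%:R = i.+2%:R :> F by rewrite -!natr1; ring.
have -> : nu + 1 / 2 + 1 + i%:R = nu + 1 / 2 + i.+1%:R by rewrite -!natr1; ring.
rewrite !invfM; move: h1 h2 h3 h4.
set p1 := poch _ _; set p2 := _ + _; set p3 := _%:R; set p4 := _%:R => h1 h2 h3 h4.
clearbody p1 p2 p3 p4; by field; rewrite h1 h2 h3 h4.
Qed.

(** The z^(j+1) coefficient of the three-term recurrence 2 (k + nu) x e_k = (k + 2 nu) e_(k+1) + k
    e_(k-1), where z = (1 - x) / 2 and x = 1 - 2 z. The truncation of [k.-1] at k = 0 is harmless
    because of the factor k. *)
Lemma gcoef_rec k j :
  2 * (k%:R + nu) * (gcoef k j.+1 - 2 * gcoef k j) =
  (k%:R + 2 * nu) * gcoef k.+1 j.+1 + k%:R * gcoef k.-1 j.+1.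
Proof.
(* The factored forms describe indices at least 1, while j = 0 involves [gcoef k 0]; that case goes
   through [gcoef1] after clearing the denominator nu + 1/2. *)
case: j => [|i].
  have h : nu + 1 / 2 != 0 by rewrite gt_eqF.
  apply: (mulfI h).
  have -> : (nu + 1 / 2) * ((k%:R + 2 * nu) * gcoef k.+1 1 + k%:R * gcoef k.-1 1) =
    (k%:R + 2 * nu) * ((nu + 1 / 2) * gcoef k.+1 1) + k%:R * ((nu + 1 / 2) * gcoef k.-1 1).
    by ring.
  have -> : (nu + 1 / 2) * (2 * (k%:R + nu) * (gcoef k 1 - 2 * gcoef k 0)) =
    2 * (k%:R + nu) * ((nu + 1 / 2) * gcoef k 1 - 2 * (nu + 1 / 2) * gcoef k 0) by ring.
  rewrite !gcoef1 gcoef0; case: k => [|k]; rewrite -?natr1 /=; by field.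
rewrite gcoefAP gcoefAS gcoefA gcoefA1 /q.
rewrite [k.+1%:R]mulrS; set a := A k i; set b := B k i; set d := (D i)^-1; by field.
Qed.

(** The z^(j+1) coefficient of 2 (k + nu) (1 - x^2) e_k' = k (k + 2 nu) (e_(k-1) - e_(k+1)): in the
    variable z, 1 - x^2 is 4 z (1 - z) and d/dx is - (1/2) d/dz. *)
Lemma gcoef_deriv k j :
  - 4 * (k%:R + nu) * (j.+1%:R * gcoef k j.+1 - j%:R * gcoef k j) =
  k%:R * (k%:R + 2 * nu) * (gcoef k.-1 j.+1 - gcoef k.+1 j.+1).
Proof.
case: j => [|i].
  have h : nu + 1 / 2 != 0 by rewrite gt_eqF.
  apply: (mulfI h).
  have -> : (nu + 1 / 2) * (k%:R * (k%:R + 2 * nu) * (gcoef k.-1 1 - gcoef k.+1 1)) =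
    k%:R * (k%:R + 2 * nu) * ((nu + 1 / 2) * gcoef k.-1 1 - (nu + 1 / 2) * gcoef k.+1 1).
    by ring.
  have -> : (nu + 1 / 2) * (- 4 * (k%:R + nu) * (1 * gcoef k 1 - 0 * gcoef k 0)) =
    - 4 * (k%:R + nu) * ((nu + 1 / 2) * gcoef k 1) by ring.
  rewrite !gcoef1; case: k => [|k]; rewrite -?natr1 /=; ring.
have -> : k%:R * (k%:R + 2 * nu) * (gcoef k.-1 i.+2 - gcoef k.+1 i.+2) =
  (k%:R + 2 * nu) * (k%:R * gcoef k.-1 i.+2 - k%:R * gcoef k.+1 i.+2) by ring.
rewrite gcoefAP gcoefAS gcoefA gcoefA1 /q.
rewrite [k.+1%:R]mulrS; set a := A k i; set b := B k i; set d := (D i)^-1; by field.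
Qed.

Let gegz k : {poly F} := \poly_(j < k.+1) gcoef k j.

Let coef_gegz k j : (gegz k)`_j = gcoef k j.
Proof. by rewrite coef_poly ltnS; case: leqP => // /gcoef_gt ->. Qed.

Let half : {poly F} := 2^-1 *: (1 - 'X).

Definition geg k : {poly F} := gegz k \Po half.

Lemma gegenbauerE k x : gegenbauer nu k x = poch (2 * nu) k / k`!%:R * (geg k).[x].
Proof.
rewrite /gegenbauer /geg horner_comp horner_poly /half.
rewrite hornerZ hornerD hornerN hornerX hornerC; congr (_ * _).
by apply: eq_bigr => j _; rewrite [X in _ * X ^+ _ = _]mulrC.
Qed.

Let gegz_rec k :
  (2 * (k%:R + nu)) *: ((1 - 2 *: 'X) * gegz k) =
  (k%:R + 2 * nu) *: gegz k.+1 + k%:R *: gegz k.-1.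
Proof.
apply/polyP => j; rewrite coefD !coefZ mulrBl mul1r coefB -scalerAl coefZ coefXM !coef_gegz.
case: j => [|j] /=; first by rewrite !gcoef0; ring.
by rewrite ?coef_gegz gcoef_rec.
Qed.

Let gegz_deriv k :
  (- 4 * (k%:R + nu)) *: ('X * (1 - 'X) * (gegz k)^`()) =
  (k%:R * (k%:R + 2 * nu)) *: (gegz k.-1 - gegz k.+1).
Proof.
apply/polyP => j; rewrite !coefZ coefB !coef_gegz -mulrA coefXM.
case: j => [|j] /=; first by rewrite !gcoef0 subrr !mulr0.
rewrite mulrBl mul1r coefB coefXM !coef_deriv -gcoef_deriv; congr (_ * _).
by case: j => [|j] /=; rewrite !coef_gegz -?[gcoef _ _ *+ _]mulr_natl ?mul0r.
Qed.

(** The hypergeometric equation in z; its z^j coefficient is the recurrence [gcoefS]. *)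
Let gegz_ode k :
  'X * (1 - 'X) * (gegz k)^`()^`() + (nu + 1 / 2) *: ((1 - 2 *: 'X) * (gegz k)^`()) =
  - (k%:R * (k%:R + 2 * nu)) *: gegz k.
Proof.
apply/polyP => j; rewrite coefD !coefZ -mulrA coefXM !mulrBl !mul1r !coefB.
rewrite -scalerAl coefZ !coefXM !coef_deriv !coef_gegz.
have := gcoefS k j.
case: j => [|[|j]] /=; rewrite ?coef_gegz -?[gcoef _ _ *+ _]mulr_natl.
- by move=> h; apply: (eq_by_sub h); rewrite -?(natr1 _ j); field.
- by move=> h; apply: (eq_by_sub h); rewrite -?(natr1 _ j); field.
- by move=> h; apply: (eq_by_sub h); rewrite -?(natr1 _ j); field.
Qed.

Let half1 : (1 - 2 *: 'X) \Po half = 'X.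
Proof.
rewrite comp_polyB comp_polyC comp_polyZ comp_polyX /half scalerA mulfV ?pnatr_eq0// scale1r.
by rewrite opprB addrC subrK.
Qed.

Let half2 : 4 *: (('X * (1 - 'X)) \Po half) = 1 - 'X^2.
Proof.
have h : 2 *: half = 1 - 'X by rewrite /half scalerA mulfV ?pnatr_eq0// scale1r.
rewrite comp_polyM comp_polyB comp_polyC comp_polyX.
have -> : 4 *: (half * (1%:P - half)) = (2 *: half) * (2%:P - 2 *: half).
  by rewrite -!mul_polyC [4%:P](_ : _ = 2%:P * 2%:P) -?polyCM; [ring|congr (_%:P); ring].
rewrite h; ring.
Qed.

Lemma deriv_geg k : (geg k)^`() = - 2^-1 *: ((gegz k)^`() \Po half).
Proof.
rewrite /geg deriv_comp /half derivZ derivB derivX derivC sub0r.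
by rewrite -scalerAr mulrN1 scalerN scaleNr.
Qed.

Lemma geg_rec k :
  (2 * (k%:R + nu)) *: ('X * geg k) =
  (k%:R + 2 * nu) *: geg k.+1 + k%:R *: geg k.-1.
Proof.
by rewrite /geg -half1 -comp_polyM -!comp_polyZ -comp_polyD gegz_rec.
Qed.

Lemma geg_deriv k :
  (2 * (k%:R + nu)) *: ((1 - 'X^2) * (geg k)^`()) =
  (k%:R * (k%:R + 2 * nu)) *: (geg k.-1 - geg k.+1).
Proof.
rewrite deriv_geg -half2 -scalerAl -scalerAr -comp_polyM /geg -comp_polyB -[RHS]comp_polyZ.
rewrite -gegz_deriv comp_polyZ !scalerA; congr (_ *: _); by field.
Qed.

Lemma geg_ode k :
  (1 - 'X^2) * (geg k)^`()^`() - (2 * nu + 1) *: ('X * (geg k)^`()) =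
  - (k%:R * (k%:R + 2 * nu)) *: geg k.
Proof.
rewrite [in RHS]/geg -comp_polyZ -gegz_ode comp_polyD comp_polyZ !comp_polyM half1.
rewrite !deriv_geg derivZ deriv_comp -half2 comp_polyM.
rewrite /half derivZ derivB derivX derivC sub0r -/half.
rewrite !(scalerN, mulrN, scaleNr, opprK, mulr1) -!scalerAr -!scalerAl -?scalerAr !scalerA.
congr (_ + _); last by congr (_ *: _); field.
by rewrite mulr1 (_ : _ * 4 = 1) ?scale1r//; field.
Qed.

End Gegenbauer.

(** * Entries of the weight matrix *)

Section BinomialSeries.
Variable F : numFieldType.
Implicit Types (a c : F) (z : int).

(* The coefficient of x^z in (1 - c x)^(-a); the value 0 at negative z makes
   the recurrence [binserS] hold on all integers. *)
Definition binser a c z : F :=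
  if z is Posz n then c ^+ n * poch a n / n`!%:R else 0.

Lemma binser_lt0 a c z : z < 0 -> binser a c z = 0.
Proof. by case: z. Qed.

Lemma binserS a c z :
  (z%:~R + 1) * binser a c (z + 1) = c * (a + z%:~R) * binser a c z.
Proof.
case: z => [n|[|n]].
- rewrite -PoszD addn1 /= pochSr exprS factS natrM -pmulrn.
  have h : n`!%:R != 0 :> F by rewrite pnatr_eq0 -lt0n fact_gt0.
  by field; rewrite h nat1r pnatr_eq0.
- by rewrite /= addNr mul0r mulr0.
- by rewrite (_ : Negz n.+1 + 1 = Negz n) ?mulr0//; lia.
Qed.

End BinomialSeries.

Section CoreIdentities.
(* The letters stand for p = rho A, p' = rho (A + 1), q = rho B, q' = rho (B + 1),
   s' = sig T, s = sig (T - 1), r' = sig D, r = sig (D - 1), so that X and Y are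
   the terms of the series at t = T and t = T - 1, and t1, ..., t4 those of its
   four neighbours. Every identity below is a combination of k1, ..., k4. *)
Variables (F : comRingType) (nu N A B T D p p' q q' s s' r r' : F).
Hypothesis hN : N = A + B + T + D.
Hypothesis hp : (A + 1) * p' = (nu + A) * p.
Hypothesis hq : (B + 1) * q' = (nu + B) * q.
Hypothesis hs : T * s' = (N + nu - T + 1) * s.
Hypothesis hr : D * r' = (N + nu - D + 1) * r.

Let X := p * q * s' * r'.
Let Y := p' * q' * s * r.
Let t1 := (B + T + 1) * (p * q' * s' * r).
Let t2 := (A + T + 1) * (p' * q * s' * r).
Let t3 := (A + D + 1) * (p' * q * s * r').
Let t4 := (B + D + 1) * (p * q' * s * r').
Let k1 := (nu + A) * p * (T * s') - (A + 1) * p' * ((N + nu - T + 1) * s).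
Let k2 := (nu + A) * p * (D * r') - (A + 1) * p' * ((N + nu - D + 1) * r).
Let k3 := (nu + B) * q * (T * s') - (B + 1) * q' * ((N + nu - T + 1) * s).
Let k4 := (nu + B) * q * (D * r') - (B + 1) * q' * ((N + nu - D + 1) * r).
Let k1_0 : k1 = 0. Proof. by rewrite /k1 hp hs subrr. Qed.
Let k2_0 : k2 = 0. Proof. by rewrite /k2 hp hr subrr. Qed.
Let k3_0 : k3 = 0. Proof. by rewrite /k3 hq hs subrr. Qed.
Let k4_0 : k4 = 0. Proof. by rewrite /k4 hq hr subrr. Qed.

(** With n = A + T and m = B + T, the terms t1, t2, t3, t4 come from the entries with m + 1, n + 1,
    m - 1, n - 1, and their leading factors are m + 1, n + 1, N - m + 1, N - n + 1. The four lemmas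
    are the e_(A+B+1) coefficients of [wser_deriv], [wser_prim_sub], [wser_mulX] and
    [wser_prim_half] respectively. *)
Lemma core_add :
  X * ((A + B + 2 * nu) * (T + D)) + Y * ((A + B + 2) * (A + B + 2 + 2 * nu + N)) =
  (A + B + 1 + nu) * (t1 + t2 + t3 + t4).
Proof.
apply/eqP; rewrite -subr_eq0; apply/eqP.
transitivity (k1 * (q * r' - q' * r) + k2 * (q * s' - q' * s)
  + k3 * (p * r' - p' * r) + k4 * (p * s' - p' * s)).
  rewrite /X /Y /t1 /t2 /t3 /t4 /k1 /k2 /k3 /k4 hN; ring.
by rewrite k1_0 k2_0 k3_0 k4_0 !mul0r !addr0.
Qed.

Lemma core_sub :
  Y * ((A - B) * (T - D)) - X * ((A - B) * (T - D)) =
  (A + B + 1 + nu) * (t2 + t4 - t1 - t3).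
Proof.
apply/eqP; rewrite -subr_eq0; apply/eqP.
transitivity (- k1 * (q * r' - q' * r) + k2 * (q * s' - q' * s)
  + k3 * (p * r' - p' * r) - k4 * (p * s' - p' * s)).
  rewrite /X /Y /t1 /t2 /t3 /t4 /k1 /k2 /k3 /k4 hN; ring.
by rewrite ?k1_0 ?k2_0 ?k3_0 ?k4_0; ring.
Qed.

Lemma core_mulX :
  X * ((D - T) * (A + B + 2 * nu)) + Y * ((D - T) * (A + B + 2)) =
  (A + B + 1 + nu) * (t1 + t2 - t3 - t4).
Proof.
apply/eqP; rewrite -subr_eq0; apply/eqP.
transitivity (- k1 * (q * r' + q' * r) + k2 * (q * s' + q' * s)
  - k3 * (p * r' + p' * r) + k4 * (p * s' + p' * s)).
  rewrite /X /Y /t1 /t2 /t3 /t4 /k1 /k2 /k3 /k4 hN; ring.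
by rewrite ?k1_0 ?k2_0 ?k3_0 ?k4_0; ring.
Qed.

Lemma core_half :
  X * (- (A + D - B - T) * (A + B + 2 * nu) + (N + 2 * nu) * (A - B)) +
  Y * (- (A + D - B - T) * (A + B + 2) - (N + 2 * nu) * (A - B)) =
  - (2 * (A + B + 1 + nu) * (t1 - t3)).
Proof.
apply/eqP; rewrite -subr_eq0; apply/eqP.
transitivity (2 * (k1 * (q * r' + q' * r) - k4 * (p * s' + p' * s))).
  rewrite /X /Y /t1 /t2 /t3 /t4 /k1 /k2 /k3 /k4 hN; ring.
by rewrite ?k1_0 ?k2_0 ?k3_0 ?k4_0; ring.
Qed.

End CoreIdentities.

Section WeightSeries.
Variables (F : numFieldType) (nu : F) (N : nat).
Hypothesis nu_gt0 : 0 < nu.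
Implicit Types (z a b t d m n k : int).

Let rho := binser nu 1.
Let sig := binser (- N%:R - nu) (-1).

Definition wterm a b t d : F := rho a * rho b * sig t * sig d.

Definition geg_int z : {poly F} := if z is Posz k then geg nu k else 0.

(* Normalized so that (1 - x^2) dgeg_z = e_(z-1) - e_(z+1) for z > 0; the value
   at z <= 0 is irrelevant. *)
Definition dgeg_int z : {poly F} :=
  if z is Posz k.+1 then
    (2 * (k.+1%:R + nu) / (k.+1%:R * (k.+1%:R + 2 * nu))) *: (geg nu k.+1)^`()
  else 0.

Let trm a b t d := (wterm a b t d * ((a + b)%:~R + nu)) *: geg_int (a + b).

(* Indices are integers, so that the shifts m + 1 and m - 1 need no boundary cases. *)
Definition wser m n : {poly F} :=
  \sum_(i < N.+2) trm (n - i%:Z) (m - i%:Z) i%:Z (N%:Z - m - n + i%:Z).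

Definition wser_prim m n : {poly F} :=
  \sum_(i < N.+2) wterm (n - i%:Z) (m - i%:Z) i%:Z (N%:Z - m - n + i%:Z)
     *: dgeg_int (n - i%:Z + (m - i%:Z)).

Lemma wterm_eq0 a b t d : [|| a < 0, b < 0, t < 0 | d < 0] -> wterm a b t d = 0.
Proof.
by rewrite /wterm /rho /sig => /or4P[] /binser_lt0 ->; rewrite ?mul0r ?mulr0 ?mul0r.
Qed.

Let wtermP a b t d :
  wterm a b t d = 0 \/ exists a' b' : nat, a = a'%:Z /\ b = b'%:Z.
Proof.
case: a => [a|a]; last by left; rewrite wterm_eq0.
by case: b => [b|b]; [right; exists a, b|left; rewrite wterm_eq0// orbT].
Qed.

Lemma wserC m n : wser m n = wser n m.
Proof.
apply: eq_bigr => i _; rewrite /trm /wterm.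
by rewrite (addrC (n - _)) (_ : N%:Z - m - n = N%:Z - n - m) 1?(mulrC (rho (n - _))); last ring.
Qed.

(** This is what the range up to N + 1 is for: when m and n are at most N the last term vanishes,
    and t can be replaced by t - 1 without leaving the range. *)
Lemma sum_shift (V : nmodType) (f : int -> V) : f (-1) = 0 -> f N.+1%:Z = 0 ->
  \sum_(i < N.+2) f i%:Z = \sum_(i < N.+2) f (i%:Z - 1).
Proof.
move=> f0 fN; rewrite big_ord_recr /= fN addr0 [RHS]big_ord_recl /=.
rewrite [f (Posz 0 - 1)]f0 add0r.
by apply: eq_bigr => i _; congr f; rewrite /bump /=; lia.
Qed.

(** The factor a + b + nu of [trm] is the one on the left of [geg_rec] and [geg_deriv], so both
    operations on a term produce no denominator. *)
Let trm_mulX a b t d : 2 *: ('X * trm a b t d) =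
  (wterm a b t d * ((a + b)%:~R + 2 * nu)) *: geg_int (a + b + 1) +
  (wterm a b t d * (a + b)%:~R) *: geg_int (a + b - 1).
Proof.
rewrite /trm; have [->|[a' [b' [-> ->]]]] := wtermP a b t d.
  by rewrite !mul0r !scale0r mulr0 scaler0 addr0.
rewrite -PoszD; set w := wterm _ _ _ _; set k := (a' + b')%N.
rewrite -PoszD addn1 /= -pmulrn -scalerAr scalerA mulrCA -[LHS]scalerA geg_rec//.
rewrite scalerDr !scalerA.
congr (_ + _); case: k => [|k]; first by rewrite !mulr0 !scale0r.
by rewrite (_ : k.+1%:Z - 1 = k%:Z)//; lia.
Qed.

Let trm_deriv a b t d : 2 *: ((1 - 'X^2) * (trm a b t d)^`()) =
  (wterm a b t d * ((a + b)%:~R * ((a + b)%:~R + 2 * nu)))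
    *: (geg_int (a + b - 1) - geg_int (a + b + 1)).
Proof.
rewrite /trm; have [->|[a' [b' [-> ->]]]] := wtermP a b t d.
  by rewrite !mul0r !scale0r deriv0 mulr0 scaler0.
rewrite -PoszD; set w := wterm _ _ _ _; set k := (a' + b')%N.
rewrite -PoszD addn1 /= -pmulrn derivZ -scalerAr scalerA mulrCA -[LHS]scalerA geg_deriv//.
rewrite !scalerA.
case: k => [|k]; first by rewrite !mul0r !mulr0 !scale0r.
by rewrite (_ : k.+1%:Z - 1 = k%:Z)//; lia.
Qed.

(** Replacing t by t - 1 raises a + b by 2, hence turns e_(a+b-1) into e_(a+b+1). After this shift
    each identity can be checked term by term. *)
Let collect (al be : F -> F) m n : (0 <= m <= N%:Z) -> (0 <= n <= N%:Z) ->
  \sum_(i < N.+2) (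
     let t := i%:Z in let a := n - t in let b := m - t in let d := N%:Z - m - n + t in
     (wterm a b t d * al (a + b)%:~R) *: geg_int (a + b + 1) +
     (wterm a b t d * be (a + b)%:~R) *: geg_int (a + b - 1)) =
  \sum_(i < N.+2) (
     let t := i%:Z in let a := n - t in let b := m - t in let d := N%:Z - m - n + t in
     (wterm a b t d * al (a + b)%:~R +
      wterm (a + 1) (b + 1) (t - 1) (d - 1) * be ((a + b)%:~R + 2))
       *: geg_int (a + b + 1)).
Proof.
move=> hm hn; rewrite big_split /=.
under [RHS]eq_bigr do rewrite scalerDl.
rewrite [RHS]big_split /=; congr (_ + _).
pose f t := (wterm (n - t) (m - t) t (N%:Z - m - n + t) * be (n - t + (m - t))%:~R)
  *: geg_int (n - t + (m - t) - 1).
transitivity (\sum_(i < N.+2) f i%:Z); first by [].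
rewrite sum_shift /f; last 2 first.
- by rewrite wterm_eq0 ?mul0r ?scale0r//; apply/or4P; constructor 3.
- by rewrite wterm_eq0 ?mul0r ?scale0r//; apply/orP; left; lia.
apply: eq_bigr => i _.
rewrite (_ : n - (i%:Z - 1) = n - i%:Z + 1); last by ring.
rewrite (_ : m - (i%:Z - 1) = m - i%:Z + 1); last by ring.
rewrite (_ : N%:Z - m - n + (i%:Z - 1) = N%:Z - m - n + i%:Z - 1); last by ring.
rewrite (_ : n - i%:Z + 1 + (m - i%:Z + 1) = n - i%:Z + (m - i%:Z) + 2); last by ring.
rewrite (_ : n - i%:Z + (m - i%:Z) + 2 - 1 = n - i%:Z + (m - i%:Z) + 1); last by ring.
by rewrite [(_ + 2)%:~R]intrD.
Qed.

Let rhoS z : (z%:~R + 1) * rho (z + 1) = (nu + z%:~R) * rho z.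
Proof. by rewrite /rho binserS mul1r. Qed.

Let sigP z : z%:~R * sig z = (N%:R + nu - z%:~R + 1) * sig (z - 1).
Proof.
have := binserS (- N%:R - nu) (-1) (z - 1); rewrite subrK intrB /sig => e.
by apply: (eq_by_sub e); ring.
Qed.

Section Entry.
Variables m n : int.
Hypotheses (hm : 0 <= m <= N%:Z) (hn : 0 <= n <= N%:Z).

Let a (i : 'I_N.+2) := n - i%:Z.
Let b (i : 'I_N.+2) := m - i%:Z.
Let d (i : 'I_N.+2) := N%:Z - m - n + i%:Z.

(** The four neighbours are aligned on e_(a+b+1). Raising m or n does this with t unchanged;
    lowering m or n requires the shift of t. *)
Let wser_Sm : wser (m + 1) n = \sum_i
  (wterm (a i) (b i + 1) i%:Z (d i - 1) * ((a i + b i)%:~R + 1 + nu)) *: geg_int (a i + b i + 1).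
Proof.
apply: eq_bigr => i _; rewrite /trm /a /b /d.
rewrite (_ : m + 1 - i%:Z = m - i%:Z + 1); last by ring.
rewrite (_ : N%:Z - (m + 1) - n + i%:Z = N%:Z - m - n + i%:Z - 1); last by ring.
by rewrite addrA [(_ + 1)%:~R]intrD.
Qed.

Let wser_Sn : wser m (n + 1) = \sum_i
  (wterm (a i + 1) (b i) i%:Z (d i - 1) * ((a i + b i)%:~R + 1 + nu)) *: geg_int (a i + b i + 1).
Proof.
apply: eq_bigr => i _; rewrite /trm /a /b /d.
rewrite (_ : n + 1 - i%:Z = n - i%:Z + 1); last by ring.
rewrite (_ : N%:Z - m - (n + 1) + i%:Z = N%:Z - m - n + i%:Z - 1); last by ring.
by rewrite (addrAC _ 1) [(_ + 1)%:~R]intrD.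
Qed.

Let wser_Pm : wser (m - 1) n = \sum_i
  (wterm (a i + 1) (b i) (i%:Z - 1) (d i) * ((a i + b i)%:~R + 1 + nu)) *: geg_int (a i + b i + 1).
Proof.
rewrite /wser.
rewrite (sum_shift (f := fun t => trm (n - t) (m - 1 - t) t (N%:Z - (m - 1) - n + t))); last 2 first.
- by rewrite /trm wterm_eq0 ?mul0r ?scale0r//; apply/or4P; constructor 3.
- by rewrite /trm wterm_eq0 ?mul0r ?scale0r//; apply/orP; left; lia.
apply: eq_bigr => i _; rewrite /trm /a /b /d.
rewrite (_ : n - (i%:Z - 1) = n - i%:Z + 1); last by ring.
rewrite (_ : m - 1 - (i%:Z - 1) = m - i%:Z); last by ring.
rewrite (_ : N%:Z - (m - 1) - n + (i%:Z - 1) = N%:Z - m - n + i%:Z); last by ring.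
by rewrite (addrAC _ 1) [(_ + 1)%:~R]intrD.
Qed.

Let wser_Pn : wser m (n - 1) = \sum_i
  (wterm (a i) (b i + 1) (i%:Z - 1) (d i) * ((a i + b i)%:~R + 1 + nu)) *: geg_int (a i + b i + 1).
Proof.
rewrite /wser.
rewrite (sum_shift (f := fun t => trm (n - 1 - t) (m - t) t (N%:Z - m - (n - 1) + t))); last 2 first.
- by rewrite /trm wterm_eq0 ?mul0r ?scale0r//; apply/or4P; constructor 3.
- by rewrite /trm wterm_eq0 ?mul0r ?scale0r//; apply/orP; left; lia.
apply: eq_bigr => i _; rewrite /trm /a /b /d.
rewrite (_ : m - (i%:Z - 1) = m - i%:Z + 1); last by ring.
rewrite (_ : n - 1 - (i%:Z - 1) = n - i%:Z); last by ring.
rewrite (_ : N%:Z - m - (n - 1) + (i%:Z - 1) = N%:Z - m - n + i%:Z); last by ring.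
by rewrite addrA [(_ + 1)%:~R]intrD.
Qed.

Let mF : F := m%:~R.
Let nF : F := n%:~R.

Let aF i : (a i)%:~R = nF - i%:R. Proof. by rewrite /a intrB. Qed.
Let bF i : (b i)%:~R = mF - i%:R. Proof. by rewrite /b intrB. Qed.
Let dF i : (d i)%:~R = N%:R - mF - nF + i%:R.
Proof. by rewrite /d intrD !intrB. Qed.

Let abtd i : N%:R = (a i)%:~R + (b i)%:~R + i%:Z%:~R + (d i)%:~R :> F.
Proof. rewrite aF bF dF; ring. Qed.

Lemma wser_mulX :
  (2 * (N%:R - mF - nF)) *: ('X * wser m n) =
  (mF + 1) *: wser (m + 1) n - (N%:R - mF + 1) *: wser (m - 1) n
  + (nF + 1) *: wser m (n + 1) - (N%:R - nF + 1) *: wser m (n - 1).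
Proof.
transitivity (\sum_(i < N.+2) (
     let t := i%:Z in let a := n - t in let b := m - t in let d := N%:Z - m - n + t in
     (wterm a b t d * ((N%:R - mF - nF) * ((a + b)%:~R + 2 * nu))) *: geg_int (a + b + 1) +
     (wterm a b t d * ((N%:R - mF - nF) * (a + b)%:~R)) *: geg_int (a + b - 1))).
  rewrite /wser mulr_sumr scaler_sumr; apply: eq_bigr => i _ /=.
  rewrite mulrC -[LHS]scalerA trm_mulX scalerDr !scalerA.
  move: (wterm _ _ _ _) (_%:~R) => w c; congr (_ *: _ + _ *: _); ring.
rewrite (collect (fun x => (N%:R - mF - nF) * (x + 2 * nu)) (fun x => (N%:R - mF - nF) * x))//.
rewrite wser_Sm wser_Pm wser_Sn wser_Pn !scaler_sumr -!sumrB -!big_split -!sumrB /=.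
apply: eq_bigr => i _; rewrite -/(a i) -/(b i) -/(d i) !scalerA.
rewrite -!(scalerBl, scalerDl); congr (_ *: _).
have e := core_mulX (abtd i) (rhoS (a i)) (rhoS (b i)) (sigP i%:Z) (sigP (d i)).
apply: (eq_by_sub e); rewrite /wterm intrD aF bF dF -!pmulrn; ring.
Qed.

Lemma wser_deriv :
  2 *: ((1 - 'X^2) * (wser m n)^`()) + (2 * N%:R) *: ('X * wser m n) =
  (mF + 1) *: wser (m + 1) n + (N%:R - mF + 1) *: wser (m - 1) n
  + (nF + 1) *: wser m (n + 1) + (N%:R - nF + 1) *: wser m (n - 1).
Proof.
transitivity (\sum_(i < N.+2) (
     let t := i%:Z in let a := n - t in let b := m - t in let d := N%:Z - m - n + t in
     (wterm a b t d * ((N%:R - (a + b)%:~R) * ((a + b)%:~R + 2 * nu))) *: geg_int (a + b + 1) +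
     (wterm a b t d * ((a + b)%:~R * ((a + b)%:~R + 2 * nu + N%:R))) *: geg_int (a + b - 1))).
  rewrite /wser raddf_sum /= !mulr_sumr !scaler_sumr -big_split; apply: eq_bigr => i _ /=.
  rewrite trm_deriv [2 * N%:R]mulrC -(scalerA N%:R) trm_mulX scalerBr scalerDr.
  rewrite !scalerA [X in X + _]addrC addrACA.
  rewrite -scaleNr -!scalerDl.
  move: (wterm _ _ _ _) (_%:~R) => w c; congr (_ *: _ + _ *: _); ring.
rewrite (collect (fun x => (N%:R - x) * (x + 2 * nu)) (fun x => x * (x + 2 * nu + N%:R)))//.
rewrite wser_Sm wser_Pm wser_Sn wser_Pn !scaler_sumr -!big_split /=.
apply: eq_bigr => i _; rewrite -/(a i) -/(b i) -/(d i) !scalerA -!scalerDl; congr (_ *: _).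
have e := core_add (abtd i) (rhoS (a i)) (rhoS (b i)) (sigP i%:Z) (sigP (d i)).
apply: (eq_by_sub e); rewrite /wterm intrD aF bF dF -!pmulrn; ring.
Qed.

(** This is (1 - x^2) [wser_prim] when m and n differ. When m = n the term a = b = 0 is not of that
    form, but then the coefficients in [Q_sub] and [Q_half] vanish. Working with [Q] keeps the
    comparison of coefficients uniform in m and n. *)
Let Q : {poly F} := \sum_(i < N.+2) wterm (a i) (b i) i%:Z (d i) *:
  (geg_int (a i + b i - 1) - geg_int (a i + b i + 1)).

Let Q_sub :
  ((nF - mF) * (mF + nF - N%:R)) *: Q =
  (nF + 1) *: wser m (n + 1) + (N%:R - nF + 1) *: wser m (n - 1)
  - (mF + 1) *: wser (m + 1) n - (N%:R - mF + 1) *: wser (m - 1) n.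
Proof.
pose c := (nF - mF) * (mF + nF - N%:R).
transitivity (\sum_(i < N.+2) (
     let t := i%:Z in let a := n - t in let b := m - t in let d := N%:Z - m - n + t in
     (wterm a b t d * - c) *: geg_int (a + b + 1) +
     (wterm a b t d * c) *: geg_int (a + b - 1))).
  rewrite scaler_sumr; apply: eq_bigr => i _ /=.
  by rewrite scalerA scalerBr addrC mulrN scaleNr [_ * c]mulrC.
rewrite (collect (fun=> - c) (fun=> c))//.
rewrite wser_Sm wser_Pm wser_Sn wser_Pn !scaler_sumr -!big_split -!sumrB /=.
apply: eq_bigr => i _; rewrite -/(a i) -/(b i) -/(d i) !scalerA.
rewrite -!(scalerBl, scalerDl); congr (_ *: _).
have e := core_sub (abtd i) (rhoS (a i)) (rhoS (b i)) (sigP i%:Z) (sigP (d i)).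
apply: (eq_by_sub e); rewrite /c /wterm intrD aF bF dF -!pmulrn; ring.
Qed.

Let Q_half :
  ((N%:R + 2 * nu) * (nF - mF)) *: Q =
  2 *: ((mF + 1) *: wser (m + 1) n - (N%:R - mF + 1) *: wser (m - 1) n
        - (N%:R - 2 * mF) *: ('X * wser m n)).
Proof.
pose c := (N%:R + 2 * nu) * (nF - mF); rewrite -/c.
suff e : - (N%:R - 2 * mF) *: (2 *: ('X * wser m n)) - c *: Q =
  - 2 *: ((mF + 1) *: wser (m + 1) n - (N%:R - mF + 1) *: wser (m - 1) n).
  have -> : c *: Q = - (- 2 *: ((mF + 1) *: wser (m + 1) n - (N%:R - mF + 1) *: wser (m - 1) n))
    - (N%:R - 2 * mF) *: (2 *: ('X * wser m n)).
    by rewrite -e opprB [X in _ - X - _]scaleNr opprK addrK.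
  by rewrite scaleNr opprK [RHS]scalerBr [X in _ - X = _]scalerA [X in _ = _ - X]scalerA [_ * 2]mulrC.
transitivity (\sum_(i < N.+2) (
     let t := i%:Z in let a := n - t in let b := m - t in let d := N%:Z - m - n + t in
     (wterm a b t d * (- (N%:R - 2 * mF) * ((a + b)%:~R + 2 * nu) + c)) *: geg_int (a + b + 1) +
     (wterm a b t d * (- (N%:R - 2 * mF) * (a + b)%:~R - c)) *: geg_int (a + b - 1))).
  rewrite /wser mulr_sumr !scaler_sumr -sumrB; apply: eq_bigr => i _ /=.
  rewrite trm_mulX /a /b /d.
  move: (wterm _ _ _ _) (geg_int (_ + 1)) (geg_int (_ - 1)) (_%:~R) (- (_ - _)) => w ep em x C.
  rewrite scalerDr !scalerA scalerBr opprB addrACA -scaleNr -!scalerDl.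
  congr (_ *: _ + _ *: _); ring.
rewrite (collect (fun x => - (N%:R - 2 * mF) * (x + 2 * nu) + c)
  (fun x => - (N%:R - 2 * mF) * x - c))//.
rewrite wser_Sm wser_Pm !scaler_sumr -!sumrB scaler_sumr /=.
apply: eq_bigr => i _; rewrite -/(a i) -/(b i) -/(d i) !scalerA.
rewrite -!scalerBl scalerA; congr (_ *: _).
have e := core_half (abtd i) (rhoS (a i)) (rhoS (b i)) (sigP i%:Z) (sigP (d i)).
apply: (eq_by_sub e); rewrite /c /wterm intrD aF bF dF -!pmulrn; ring.
Qed.

Let dgeg_mul z : 0 < z -> (1 - 'X^2) * dgeg_int z = geg_int (z - 1) - geg_int (z + 1).
Proof.
case: z => [[|k]|]// _; rewrite -PoszD addn1 (_ : k.+1%:Z - 1 = k%:Z) /=; last by lia.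
have h1 : 0 < k.+1%:R + 2 * nu by rewrite addr_gt0 ?mulr_gt0 ?ltr0n.
have h2 : k.+1%:R != 0 :> F by rewrite pnatr_eq0.
rewrite -scalerAr -[2 * _ / _]mulrC -scalerA geg_deriv// scalerA mulVf ?scale1r//.
by rewrite mulf_neq0// gt_eqF.
Qed.

Let dgeg_ode z : 0 < z -> (1 - 'X^2) * (dgeg_int z)^`() - (2 * nu + 1) *: ('X * dgeg_int z) =
  (- 2 * (z%:~R + nu)) *: geg_int z.
Proof.
case: z => [[|k]|]// _; rewrite -pmulrn /=.
have h1 : 0 < k.+1%:R + 2 * nu by rewrite addr_gt0 ?mulr_gt0 ?ltr0n.
have h2 : k.+1%:R != 0 :> F by rewrite pnatr_eq0.
rewrite derivZ -!scalerAr [X in _ - X]scalerA [(2 * nu + 1) * _]mulrC -[X in _ - X]scalerA.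
rewrite -scalerBr geg_ode// scalerA; congr (_ *: _).
by field; rewrite nat1r h2 gt_eqF.
Qed.

Let ab_gt0 i : m != n -> wterm (a i) (b i) i%:Z (d i) != 0 -> 0 < a i + b i.
Proof.
move=> mn; case: (ltP (a i) 0) => a0; first by rewrite wterm_eq0 ?a0 ?eqxx.
case: (ltP (b i) 0) => b0; first by rewrite wterm_eq0 ?b0 ?orbT ?eqxx.
by move=> _; move: a0 b0; rewrite /a /b; lia.
Qed.

Let prim_mul : m != n -> (1 - 'X^2) * wser_prim m n = Q.
Proof.
move=> mn; rewrite mulr_sumr; apply: eq_bigr => i _; rewrite -scalerAr -/(a i) -/(b i) -/(d i).
have [->|/(ab_gt0 mn) ab] := eqVneq (wterm (a i) (b i) i%:Z (d i)) 0; first by rewrite !scale0r.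
by rewrite dgeg_mul.
Qed.

(** For m and n distinct, (1 - x^2)^(nu + 1/2) [wser_prim] is a primitive of - 2 (1 - x^2)^(nu -
    1/2) [wser]: each term satisfies the Gegenbauer equation. The factor n - m covers the diagonal,
    where e_0 can occur. *)
Lemma wser_prim_deriv :
  (nF - mF) *: ((1 - 'X^2) * (wser_prim m n)^`() - (2 * nu + 1) *: ('X * wser_prim m n)) =
  (- 2 * (nF - mF)) *: wser m n.
Proof.
have [mn|mn] := eqVneq m n; first by rewrite /nF /mF mn subrr mulr0 !scale0r.
rewrite [- 2 * _]mulrC -[RHS]scalerA; congr (_ *: _).
rewrite /wser_prim /wser raddf_sum /= !mulr_sumr !scaler_sumr -sumrB; apply: eq_bigr => i _.
rewrite -/(a i) -/(b i) -/(d i) derivZ -!scalerAr [X in _ - X]scalerA.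
rewrite [(2 * nu + 1) * _]mulrC -[X in _ - X]scalerA -scalerBr /trm.
have [->|/(ab_gt0 mn) ab] := eqVneq (wterm (a i) (b i) i%:Z (d i)) 0.
  by rewrite !mul0r !scale0r scaler0.
by rewrite dgeg_ode// !scalerA; congr (_ *: _); ring.
Qed.

Lemma wser_prim_sub :
  ((nF - mF) * (mF + nF - N%:R)) *: ((1 - 'X^2) * wser_prim m n) =
  (nF + 1) *: wser m (n + 1) + (N%:R - nF + 1) *: wser m (n - 1)
  - (mF + 1) *: wser (m + 1) n - (N%:R - mF + 1) *: wser (m - 1) n.
Proof.
rewrite -Q_sub; have [mn|mn] := eqVneq m n; last by rewrite prim_mul.
by rewrite /nF /mF mn subrr mul0r !scale0r.
Qed.

Lemma wser_prim_half :
  ((N%:R + 2 * nu) * (nF - mF)) *: ((1 - 'X^2) * wser_prim m n) =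
  2 *: ((mF + 1) *: wser (m + 1) n - (N%:R - mF + 1) *: wser (m - 1) n
        - (N%:R - 2 * mF) *: ('X * wser m n)).
Proof.
rewrite -Q_half; have [mn|mn] := eqVneq m n; last by rewrite prim_mul.
by rewrite /nF /mF mn subrr mulr0 !scale0r.
Qed.

End Entry.

End WeightSeries.

(** The last d factors, read backwards with opposite signs. *)
Lemma poch_rev (F : numFieldType) (nu : F) M d :
  poch nu (M + d) = poch nu M * ((-1) ^+ d * poch (1 - (nu + (M + d)%:R)) d).
Proof.
elim: d => [|d IH]; first by rewrite addn0 poch0 !mulr1.
rewrite addnS pochSr IH pochS exprS -natr1.
rewrite (_ : 1 - (nu + ((M + d)%:R + 1)) + 1 = 1 - (nu + (M + d)%:R)); last by ring.
ring.
Qed.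

Lemma poch1 (F : numFieldType) n : poch (1 : F) n = n`!%:R.
Proof. by elim: n => [|n IH]; rewrite ?poch0// pochSr IH factS natrM nat1r mulrC. Qed.

(** * Comparison of the weight with its symmetric series *)

Section Weight.
Variables (R : realType) (N : nat) (nu : R).
Hypothesis nu_gt0 : 0 < nu.

Definition wscale (m n : nat) : R :=
  m`!%:R * n`!%:R * (N - m)`!%:R * (N - n)`!%:R / (N`!%:R * poch nu N).

Definition wpoly (m n : nat) : {poly R} := wscale m n *: wser nu N m%:Z n%:Z.

(** The formula for alpha hides the symmetry between t and d = N + t - m - n. Reversing products
    ([e1], [e2]) turns (n - N)_(m-t) into (N - n)! / d! and the inverse of (nu)_(n+m-t) (n + m - t +
    nu) into (- N - nu)_d, up to signs and factors free of t. The left side includes the ratio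
    between the Gegenbauer polynomial and e_(m+n-2t). *)
Lemma alpha_wterm t m n : (t <= m)%N -> (m <= n)%N -> (n <= N)%N -> (n + m - N <= t)%N ->
  alpha N nu t m n * (poch (2 * nu) (m + n - 2 * t) / (m + n - 2 * t)`!%:R) =
  wscale m n * (wterm nu N (n - t)%:Z (m - t)%:Z t%:Z (N + t - m - n)%:Z
                * ((m + n - 2 * t)%:R + nu)).
Proof.
move=> tm mn nN Nt.
pose a := (n - t)%N; pose b := (m - t)%N; pose d := (N + t - m - n)%N.
have eN : N = (a + b + t + d)%N by rewrite /a /b /d; lia.
have en : n = (a + t)%N by rewrite /a; lia.
have em : m = (b + t)%N by rewrite /b; lia.
rewrite /alpha /wterm /wscale /= -/a -/b -/d.
rewrite (_ : (m + n - 2 * t)%N = (a + b)%N); last by lia.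
rewrite (_ : (n + m - 2 * t)%N = (a + b)%N); last by lia.
rewrite (_ : (n + m - t)%N = (a + b + t)%N); last by lia.
rewrite (_ : (N - m)%N = (a + d)%N); last by lia.
rewrite (_ : (N - n)%N = (b + d)%N); last by lia.
have f0 k : k`!%:R != 0 :> R by rewrite pnatr_eq0 -lt0n fact_gt0.
have p0 (x : R) k : 0 < x -> poch x k != 0 by move=> x0; rewrite gt_eqF ?poch_gt0.
have e1 : (b + d)`!%:R = d`!%:R * ((-1) ^+ b * poch (n%:R - N%:R) b) :> R.
  rewrite -!poch1 addnC poch_rev; congr (_ * (_ * poch _ _)).
  by rewrite en eN !natrD; ring.
have e2 : poch nu N * (nu + N%:R) =
    poch nu (a + b + t) * (nu + (a + b + t)%:R) * ((-1) ^+ d * poch (- N%:R - nu) d).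
  rewrite -!pochSr [in LHS]eN -addSn poch_rev; congr (_ * (_ * poch _ _)).
  by rewrite eN addSn -natr1 !natrD; ring.
have nuD k : nu + k%:R != 0 by rewrite gt_eqF// ltr_wpDr.
rewrite [in (-1) ^+ m]em exprD e1 !expr1n !mul1r.
have Z0 : (-1) ^+ d * poch (- N%:R - nu) d != 0.
  have : poch nu N * (nu + N%:R) != 0 by rewrite mulf_neq0// p0.
  by rewrite e2 mulf_eq0 negb_or => /andP[].
have -> : poch nu N = poch nu (a + b + t) * (nu + (a + b + t)%:R)
    * ((-1) ^+ d * poch (- N%:R - nu) d) / (nu + N%:R).
  by rewrite -e2 mulfK.
have q0 : poch (2 * nu) (a + b) != 0 by apply: p0; rewrite mulr_gt0.
move: (f0 t) (f0 a) (f0 b) (f0 d) (f0 N) (f0 (a + b)%N) (nuD N) (nuD (a + b + t)%N).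
move: (p0 nu (a + b + t)%N nu_gt0) Z0 q0.
move: (n`!%:R) (m`!%:R) (t`!%:R) (a`!%:R) (b`!%:R) (d`!%:R) (N`!%:R) ((a + b)`!%:R).
move: ((a + d)`!%:R) (poch (2 * nu) _) (poch nu (a + b + t)) (poch nu a) (poch nu b).
move: (poch (n%:R - N%:R) b) (poch (- N%:R - nu) t) ((-1) ^+ d * _) ((-1) ^+ b) ((-1) ^+ t).
move: ((a + b)%:R) ((a + b + t)%:R) (N%:R).
move=> x1 x2 x3 y1 y2 y3 y4 y5 y6 y7 y8 y9 z1 z2 z3 z4 z5 z6 z7 z8 z9.
move=> h1 h2 h3 h4 h5 h6 h7 h8 h9 h10 h11; field.
by rewrite h1 h2 h3 h4 h5 h6 h7 h8 h9 h10 h11.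
Qed.

Lemma wscaleC m n : wscale m n = wscale n m.
Proof. by rewrite /wscale; congr (_ / _); ring. Qed.

Lemma wpolyC m n : wpoly m n = wpoly n m.
Proof. by rewrite /wpoly wscaleC wserC. Qed.

Lemma weightE x (i j : 'I_N.+1) :
  weight N nu x i j = (wpoly i j).[x] * gweight (nu - 1 / 2) x.
Proof.
rewrite mxE; wlog ij : i j / (i <= j)%N => [W|].
  case/orP: (leq_total i j) => [/W//|/W]; rewrite minnC maxnC => ->.
  by rewrite wpolyC.
rewrite (minn_idPl ij) (maxn_idPr ij) /weight_upper mulrC; congr (_ * _).
have jN : (j <= N)%N by rewrite -ltnS.
(* Both ranges of t are extended to 0, ..., N + 1: the added terms of the series vanish, since b < 0
   above m and d < 0 below n + m - N. *)
rewrite big_geq_mkord (big_ord_widen_cond N.+2 (fun t => (j + i - N <= t)%N)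
  (fun t => alpha N nu t i j * gegenbauer nu (i + j - 2 * t) x)); last by lia.
rewrite /wpoly hornerZ /wser horner_sum mulr_sumr big_mkcond /=; apply: eq_bigr => t _.
case: ifPn => [/andP[h1 h2]|h].
  rewrite ltnS in h2.
  rewrite gegenbauerE// mulrA alpha_wterm//.
  rewrite hornerZ -[LHS]mulrA; congr (_ * (_ * _ * _)).
    by congr (wterm _ _ _ _ _ _); lia.
    by rewrite (_ : j%:Z - t%:Z + (i%:Z - t%:Z) = (i + j - 2 * t)%N%:Z)//; lia.
  by rewrite (_ : j%:Z - t%:Z + (i%:Z - t%:Z) = (i + j - 2 * t)%N%:Z)//; lia.
rewrite wterm_eq0 ?mul0r ?scale0r ?horner0 ?mulr0//.
move: h; rewrite negb_and -leqNgt -ltnNge => /orP[h|h]; apply/or4P.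
  by constructor 4; lia.
by constructor 2; lia.
Qed.

End Weight.

(** * Moment matrices *)

Section Shifts.
Variables (F : numFieldType) (N : nat).
Implicit Types (c : nat -> F) (G : nat -> nat -> F).

Local Notation E i j := (delta_mx (inord i) (inord j) : 'M[F]_N.+1).
Local Notation mxof G := (\matrix_(i < N.+1, j < N.+1) G (i : nat) (j : nat)).

Let eq_inord (a : 'I_N.+1) t : (t <= N)%N -> (a == inord t) = (a == t :> nat).
Proof. by move=> tN; rewrite -val_eqE /= inordK. Qed.

Let delta_mul i j (A : 'M[F]_N.+1) a b : (E i j *m A) a b = (a == inord i)%:R * A (inord j) b.
Proof.
rewrite mxE (bigD1 (inord j)) //= mxE eqxx andbT big1 ?addr0// => k kj.
by rewrite mxE (negbTE kj) andbF mul0r.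
Qed.

Lemma sum_diag c : \sum_(0 <= t < N.+1) c t *: E t t = diag_mx (\row_j c j).
Proof.
apply/matrixP => a b; rewrite summxE !mxE big_mkord (bigD1 a) //= big1 => [|i ia].
  rewrite addr0 !mxE inord_val eqxx eq_sym. by rewrite mulr_natr.
by rewrite !mxE inord_val [a == i]eq_sym (negbTE ia) mulr0.
Qed.

(** [G] lives on all naturals so that the last row needs no separate formula: there [G a.+1 b] lies
    outside the matrix and is cancelled by [c N = 0]. *)
Lemma sum_up c G a b : c N = 0 ->
  ((\sum_(0 <= t < N) c t *: E t t.+1) *m mxof G) a b = c a * G a.+1 b.
Proof.
move=> cN; rewrite mulmx_suml summxE big_mkord.
have [aN|aN] := ltnP a N.
  rewrite (bigD1 (Ordinal aN)) //= big1 ?addr0 => [|i ia].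
    by rewrite -scalemxAl mxE delta_mul inord_val eqxx mul1r mxE inordK.
  rewrite -scalemxAl mxE delta_mul eq_inord; last by rewrite ltnW.
  by rewrite eq_sym -[nat_of_ord a]/(nat_of_ord (Ordinal aN)) val_eqE (negbTE ia) mul0r mulr0.
have -> : (a : nat) = N by apply/eqP; rewrite eqn_leq aN -ltnS ltn_ord.
rewrite cN mul0r big1// => i _; rewrite -scalemxAl mxE delta_mul eq_inord; last by rewrite ltnW.
by rewrite gtn_eqF ?mul0r ?mulr0// (leq_trans (ltn_ord i) aN).
Qed.

Lemma sum_down c G a b : c 0%N = 0 ->
  ((\sum_(1 <= t < N.+1) c t *: E t t.-1) *m mxof G) a b = c a * G a.-1 b.
Proof.
move=> c0; have -> : \sum_(1 <= t < N.+1) c t *: E t t.-1 = \sum_(0 <= t < N.+1) c t *: E t t.-1.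
  by rewrite [RHS]big_nat_recl// big_add1 c0 scale0r add0r.
rewrite mulmx_suml summxE big_mkord (bigD1 a) //= big1 ?addr0 => [|i ia].
  rewrite -scalemxAl mxE delta_mul inord_val eqxx mul1r mxE inordK//.
  by rewrite (leq_ltn_trans (leq_pred _)).
by rewrite -scalemxAl mxE delta_mul inord_val eq_sym (negbTE ia) mul0r mulr0.
Qed.

End Shifts.

Section Moments.
Variables (R : realType) (N : nat) (nu : R).
Hypothesis nu_gt0 : 0 < nu.

Local Notation wp := (wpoly N nu).
Local Notation L := (gweight_int (nu - 1 / 2)).

Let s_gt : -1 < nu - 1 / 2.
Proof. by move: nu_gt0; lra. Qed.

(** The ratio of [wscale] at m + 1 and at m is (m + 1) / (N - m). This converts the coefficients of
    the series identities into the entries of C and B0. At m = N both sides are 0. *)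
Let up m n : (m <= N)%N -> (n <= N)%N ->
  (N%:R - m%:R) *: wp m.+1 n = wscale N nu m n *: ((m%:R + 1) *: wser nu N (m%:Z + 1) n).
Proof.
move=> mN nN; rewrite /wpoly scalerA scalerA -PoszD addn1.
move: mN; rewrite leq_eqVlt => /orP[/eqP ->|mN].
  rewrite subrr mul0r scale0r /wser big1 ?scaler0// => i _.
  rewrite wterm_eq0 ?mul0r ?scale0r//.
  by case: (leqP i n) => h; apply/or4P; [constructor 4|constructor 1]; lia.
congr (_ *: _); rewrite /wscale -natrB ?(ltnW mN)// factS subnS.
have -> : ((N - m)`! = (N - m) * (N - m).-1`!)%N by rewrite -subn_gt0 in mN; case: (N - m)%N mN.
rewrite !natrM -natr1; ring.
Qed.

Let down m n : (m <= N)%N -> (n <= N)%N ->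
  m%:R *: wp m.-1 n = wscale N nu m n *: ((N%:R - m%:R + 1) *: wser nu N (m%:Z - 1) n).
Proof.
move=> mN nN; rewrite /wpoly scalerA scalerA; case: m mN => [|m] mN.
  rewrite mul0r scale0r /wser big1 ?scaler0// => i _.
  by rewrite wterm_eq0 ?mul0r ?scale0r//; apply/or4P; constructor 2; lia.
rewrite (_ : m.+1%:Z - 1 = m%:Z); last by lia.
congr (_ *: _); rewrite /wscale factS /= -natrB// subnS natr1 prednK ?subn_gt0//.
have -> : ((N - m)`! = (N - m) * (N - m).-1`!)%N by rewrite -subn_gt0 in mN; case: (N - m)%N mN.
rewrite !natrM; ring.
Qed.

(* In the lemmas below [pmom k.-1] always comes with a factor k, so its value at
   k = 0 does not matter. *)
Definition pmom k (p : {poly R}) : R := L ('X^k * p).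

Let pmomD k p q : pmom k (p + q) = pmom k p + pmom k q.
Proof. by rewrite /pmom mulrDr gweight_intD. Qed.

Let pmomZ k c p : pmom k (c *: p) = c * pmom k p.
Proof. by rewrite /pmom -scalerAr gweight_intZ. Qed.

Let pmomN k p : pmom k (- p) = - pmom k p.
Proof. by rewrite /pmom mulrN gweight_intN. Qed.

Let pmomX k p : pmom k ('X * p) = pmom k.+1 p.
Proof. by rewrite /pmom exprSr mulrA. Qed.

Let pmom_onem k p : k%:R * pmom k.-1 ((1 - 'X^2) * p) = k%:R * (pmom k.-1 p - pmom k.+1 p).
Proof.
case: k => [|k]; first by rewrite !mul0r.
by rewrite mulrBl mul1r pmomD pmomN expr2 -mulrA !pmomX.
Qed.

(** Integration by parts: [gweight_int_pearson] for x^k p, with the derivative of x^k moved to the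
    right. *)
Let pmom_pearson k p :
  pmom k ((1 - 'X^2) * p^`() - (2 * nu + 1) *: ('X * p)) = - (k%:R * pmom k.-1 ((1 - 'X^2) * p)).
Proof.
have := gweight_int_pearson s_gt ('X^k * p).
rewrite (_ : 2 * (nu - 1 / 2 + 1) = 2 * nu + 1); last by field.
rewrite derivM derivXn (_ : _ - _ = 'X^k * ((1 - 'X^2) * p^`() - (2 * nu + 1) *: ('X * p))
  + k%:R *: ('X^(k.-1) * ((1 - 'X^2) * p))).
  by rewrite gweight_intD// gweight_intZ// => /eqP; rewrite addr_eq0 => /eqP.
rewrite scaler_nat -!mul_polyC; ring.
Qed.

(** Entries of C Wp and of N B0 Wp. As Wp is symmetric, exchanging m and n gives the entries of Wp
    C^T and of N Wp B0^T. *)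
Let Cl m n : {poly R} := (N%:R - m%:R) *: wp m.+1 n + m%:R *: wp m.-1 n.
Let Bl m n : {poly R} := (N%:R - m%:R) *: wp m.+1 n - m%:R *: wp m.-1 n.

Section Entry.
Variables m n : nat.
Hypotheses (mN : (m <= N)%N) (nN : (n <= N)%N).

Let hm : (0 <= m%:Z <= N%:Z). Proof. by lia. Qed.
Let hn : (0 <= n%:Z <= N%:Z). Proof. by lia. Qed.
Let sc := wscale N nu m n.
Let Hp : {poly R} := sc *: wser_prim nu N m n.

Let upl := up mN nN.
Let downl := down mN nN.
Let upr : (N%:R - n%:R) *: wp n.+1 m = sc *: ((n%:R + 1) *: wser nu N m (n%:Z + 1)).
Proof. by rewrite up// wserC wscaleC. Qed.
Let downr : n%:R *: wp n.-1 m = sc *: ((N%:R - n%:R + 1) *: wser nu N m (n%:Z - 1)).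
Proof. by rewrite down// wserC wscaleC. Qed.

(** In matrix form: 2 (1 - x^2) Wp' + 2 N x Wp = C Wp + Wp C^T. Likewise [P3] reads x (B1 Wp + Wp
    B1) + B0 Wp + Wp B0^T = 0. *)
Let P1 : 2 *: ((1 - 'X^2) * (wp m n)^`()) + (2 * N%:R) *: ('X * wp m n) = Cl m n + Cl n m.
Proof.
rewrite /Cl upl downl upr downr -!scalerDr addrA.
have := wser_deriv nu_gt0 hm hn; rewrite -!pmulrn => <-.
rewrite /wpoly derivZ -!scalerAr scalerDr !scalerA; congr (_ *: _ + _ *: _); rewrite /sc; ring.
Qed.

(** The coefficient (n - m) (m + n - N) is the difference of the diagonal entries of V at n and m,
    which is how the commutator of M with V arises. *)
Let P2 : ((n%:R - m%:R) * (m%:R + n%:R - N%:R)) *: ((1 - 'X^2) * Hp) = Cl n m - Cl m n.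
Proof.
rewrite /Cl upl downl upr downr -!scalerDr -scalerBr opprD addrA.
have := wser_prim_sub nu_gt0 hm hn; rewrite -!pmulrn => <-.
by rewrite /Hp -!scalerAr !scalerA mulrC.
Qed.

Let P3 : (2 * (N%:R - m%:R - n%:R)) *: ('X * wp m n) = Bl m n + Bl n m.
Proof.
rewrite /Bl upl downl upr downr -!scalerBr -!scalerDr addrA.
have := wser_mulX nu_gt0 hm hn; rewrite -!pmulrn => <-.
by rewrite /wpoly -!scalerAr !scalerA mulrC.
Qed.

Let P4 : ((N%:R + 2 * nu) * (n%:R - m%:R)) *: ((1 - 'X^2) * Hp) =
  2 *: (Bl m n - (N%:R - 2 * m%:R) *: ('X * wp m n)).
Proof.
rewrite /Bl upl downl /Hp /wpoly -!scalerAr.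
have := wser_prim_half nu_gt0 hm hn; rewrite -!pmulrn => e.
rewrite [LHS]scalerA mulrC -[LHS]scalerA e -/sc.
rewrite [X in _ = 2 *: (_ - X)]scalerA [X in _ = 2 *: (_ - X *: _)]mulrC.
rewrite -[X in _ = 2 *: (_ - X)]scalerA.
by rewrite -!scalerBr !scalerA mulrC.
Qed.

Let P5 : (n%:R - m%:R) *: ((1 - 'X^2) * Hp^`() - (2 * nu + 1) *: ('X * Hp)) =
  (- 2 * (n%:R - m%:R)) *: wp m n.
Proof.
rewrite /Hp /wpoly derivZ -!scalerAr [X in _ *: (_ - X)]scalerA [(_ + 1) * sc]mulrC.
rewrite -[X in _ *: (_ - X)]scalerA -scalerBr.
have := wser_prim_deriv nu_gt0 hm hn; rewrite -!pmulrn => e.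
by rewrite [LHS]scalerA [(_ - _) * sc]mulrC -[LHS]scalerA e !scalerA [sc * _]mulrC.
Qed.

(** [P1] is multiplied by x^k and integrated; integration by parts removes the derivative of
    [wp]. *)
Lemma mom_add k : 2 * k%:R * (pmom k.-1 (wp m n) - pmom k.+1 (wp m n))
  + (pmom k (Cl m n) + pmom k (Cl n m)) - 2 * (N%:R + 2 * nu + 1) * pmom k.+1 (wp m n) = 0.
Proof.
have := pmom_pearson k (wp m n); rewrite pmom_onem pmomD pmomN pmomZ pmomX => e.
have := congr1 (pmom k) P1; rewrite !pmomD (pmomZ _ 2) (pmomZ _ (2 * N%:R)) pmomX => <-.
have -> : pmom k ((1 - 'X^2) * (wp m n)^`()) = (2 * nu + 1) * pmom k.+1 (wp m n)
   - k%:R * (pmom k.-1 (wp m n) - pmom k.+1 (wp m n)) by rewrite -e; ring.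
ring.
Qed.

(** By [P5] and integration by parts, for m and n distinct, the moment of index k of [wp] is k / 2
    times that of index k - 1 of (1 - x^2) [Hp], which [P2] evaluates. The same argument with [P4]
    gives [mom_half]. *)
Lemma mom_sub k : k%:R * (pmom k.-1 (Cl m n) - pmom k.-1 (Cl n m))
  + 2 * ((n%:R - m%:R) * (m%:R + n%:R - N%:R)) * pmom k (wp m n) = 0.
Proof.
have := congr1 (pmom k.-1) P2; rewrite pmomZ pmomD pmomN => e2.
have := congr1 (pmom k) P5; rewrite pmomZ [RHS]pmomZ pmom_pearson => e5.
have -> : pmom k.-1 (Cl m n) - pmom k.-1 (Cl n m) =
  - (((n%:R - m%:R) * (m%:R + n%:R - N%:R)) * pmom k.-1 ((1 - 'X^2) * Hp)) by rewrite e2 opprB.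
transitivity ((m%:R + n%:R - N%:R) *
  ((n%:R - m%:R) * - (k%:R * pmom k.-1 ((1 - 'X^2) * Hp)) - (- 2 * (n%:R - m%:R) * pmom k (wp m n)))).
  by ring.
by rewrite e5 subrr mulr0.
Qed.

Lemma mom_mulX k : 2 * (N%:R - m%:R - n%:R) * pmom k.+1 (wp m n) = pmom k (Bl m n) + pmom k (Bl n m).
Proof. by have := congr1 (pmom k) P3; rewrite pmomZ pmomX pmomD. Qed.

Lemma mom_half k : k%:R * (pmom k.-1 (Bl m n) - (N%:R - 2 * m%:R) * pmom k (wp m n))
  = (N%:R + 2 * nu) * (n%:R - m%:R) * pmom k (wp m n).
Proof.
have -> : k%:R * (pmom k.-1 (Bl m n) - (N%:R - 2 * m%:R) * pmom k (wp m n)) =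
  k%:R * pmom k.-1 (Bl m n - (N%:R - 2 * m%:R) *: ('X * wp m n)).
  by case: k => [|k]; rewrite ?mul0r// pmomD pmomN (pmomZ _ (N%:R - 2 * m%:R)) pmomX.
have := congr1 (pmom k.-1) P4; rewrite (pmomZ _ (_ * (_ - _))) (pmomZ _ 2) => e4.
have := congr1 (pmom k) P5; rewrite pmomZ [RHS]pmomZ pmom_pearson => e5.
have n2 : (2 : R) != 0 by rewrite pnatr_eq0.
apply: (mulfI n2); rewrite mulrCA -e4.
transitivity (- (N%:R + 2 * nu) * ((n%:R - m%:R) * - (k%:R * pmom k.-1 ((1 - 'X^2) * Hp)))).
  by ring.
rewrite e5; ring.
Qed.

End Entry.

Hypothesis N_gt0 : (0 < N)%N.

Local Notation M := (moment (N := N) nu (fun i j => wp i j)).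
Local Notation C := (matC R N).
Local Notation B0 := (matB0 R N).
Local Notation B1 := (matB1 R N).
Local Notation V := (matV R N).
Local Notation A0 := (matA0 N nu).

Let ME k i j : M k i j = pmom k (wp i j).
Proof. by rewrite mxE. Qed.

Let M_tr k : (M k)^T = M k.
Proof. by apply/matrixP => i j; rewrite mxE !ME wpolyC. Qed.

Let MG k : M k = \matrix_(i, j) (fun a b : nat => pmom k (wp a b)) i j.
Proof. by apply/matrixP => i j; rewrite !mxE. Qed.

Let up_mul k i j : ((\sum_(0 <= t < N) (N%:R - t%:R)
    *: (delta_mx (inord t) (inord t.+1) : 'M[R]_N.+1)) *m M k) i j =
  (N%:R - i%:R) * pmom k (wp i.+1 j).
Proof.
rewrite MG; apply: (@sum_up _ N (fun t => N%:R - t%:R) (fun a b => pmom k (wp a b))).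
by rewrite subrr.
Qed.

Let down_mul k i j : ((\sum_(1 <= t < N.+1) t%:R
    *: (delta_mx (inord t) (inord t.-1) : 'M[R]_N.+1)) *m M k) i j =
  i%:R * pmom k (wp i.-1 j).
Proof. by rewrite MG; apply: (@sum_down _ N (fun t => t%:R) (fun a b => pmom k (wp a b))). Qed.

Let C_mul k i j : (C *m M k) i j = pmom k (Cl i j).
Proof. by rewrite /matC mulmxDl [LHS]mxE up_mul down_mul /Cl pmomD !pmomZ. Qed.

Let C_mulr k i j : (M k *m C^T) i j = pmom k (Cl j i).
Proof. by rewrite -[M k]M_tr -trmx_mul mxE C_mul. Qed.

Let B0_mul k i j : (B0 *m M k) i j = N%:R^-1 * pmom k (Bl i j).
Proof.
have e (a : R) (X Y : 'M[R]_N.+1) : (a *: (X - Y)) i j = a * (X i j - Y i j) by rewrite !mxE.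
by rewrite /matB0 -scalemxAl mulmxBl e up_mul down_mul /Bl pmomD pmomN !pmomZ.
Qed.

Let B0_mulr k i j : (M k *m B0^T) i j = N%:R^-1 * pmom k (Bl j i).
Proof. by rewrite -[M k]M_tr -trmx_mul mxE B0_mul. Qed.

Let N_neq0 : N%:R != 0 :> R. Proof. by rewrite pnatr_eq0 -lt0n. Qed.

Let B1E : B1 = diag_mx (\row_j (- (N%:R - 2 * j%:R) / N%:R)).
Proof.
rewrite /matB1 sum_diag -raddfN -linearZ; congr diag_mx; apply/rowP => j.
by rewrite !mxE /ell; field.
Qed.

Let VE : V = diag_mx (\row_j (- (j%:R * (N%:R - j%:R)))).
Proof. by rewrite /matV sum_diag -raddfN; congr diag_mx; apply/rowP => j; rewrite !mxE. Qed.

Let A0E : A0 = diag_mx (\row_j (((N%:R + 2) * (j%:R - N%:R) - (nu - 1) * (N%:R - 2 * j%:R)) / N%:R)).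
Proof.
rewrite /matA0 sum_diag -linearZ; congr diag_mx; apply/rowP => j.
by rewrite !mxE /ell; field.
Qed.

Let ordN (i : 'I_N.+1) : (i <= N)%N. Proof. by rewrite -ltnS. Qed.

Lemma moment_add k : (2 * k%:R) *: (M k.-1 - M k.+1) + (C *m M k + M k *m C^T)
  - (2 * (N%:R + 2 * nu + 1)) *: M k.+1 = 0.
Proof.
apply/matrixP => i j; have := mom_add (ordN i) (ordN j) k.
rewrite -!ME -C_mul -C_mulr.
move: (M k.-1) (M k.+1) (C *m M k) (M k *m C^T) => X Y Z W e.
by rewrite !mxE -[RHS]e; ring.
Qed.

Lemma moment_sub k : k%:R *: (C *m M k.-1 - M k.-1 *m C^T) + 2 *: (M k *m V - V *m M k) = 0.
Proof.
apply/matrixP => i j; have := mom_sub (ordN i) (ordN j) k.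
rewrite -!ME -C_mul -C_mulr VE mul_diag_mx mul_mx_diag.
move: (M k) (C *m M k.-1) (M k.-1 *m C^T) => X Z W e.
by rewrite !mxE -[RHS]e; ring.
Qed.

Lemma moment_skew k : B1 *m M k.+1 + B0 *m M k + M k.+1 *m B1 + M k *m B0^T = 0.
Proof.
apply/matrixP => i j; have := mom_mulX (ordN i) (ordN j) k.
have hl := B0_mul k i j; have hr := B0_mulr k i j.
rewrite -ME; move: hl hr; rewrite B1E mul_diag_mx mul_mx_diag.
move: (M k.+1) (B0 *m M k) (M k *m B0^T) => X Z W hl hr e.
rewrite !mxE hl hr.
transitivity (N%:R^-1 * (pmom k (Bl i j) + pmom k (Bl j i) - 2 * (N%:R - i%:R - j%:R) * X i j)).
  by field.
by rewrite e subrr mulr0.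
Qed.

(** The difference of the diagonal entries of A0 at i and j is (N + 2 nu) (i - j) / N, so this is
    [mom_half] divided by N. *)
Lemma moment_half k : k%:R *: (B1 *m M k + B0 *m M k.-1) + A0 *m M k - M k *m A0 = 0.
Proof.
apply/matrixP => i j; have := mom_half (ordN i) (ordN j) k.
have hl := B0_mul k.-1 i j.
rewrite -ME; move: hl; rewrite A0E B1E !mul_diag_mx mul_mx_diag.
move: (M k) (B0 *m M k.-1) => X Z hl e.
rewrite !mxE hl.
transitivity (N%:R^-1 * (k%:R * (pmom k.-1 (Bl i j) - (N%:R - 2 * i%:R) * X i j)
  - (N%:R + 2 * nu) * (j%:R - i%:R) * X i j)).
  by field.
by rewrite e subrr mulr0.
Qed.

End Moments.

(** * Symmetry and orthogonality *)

Local Open Scope sesquilinear_scope.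

Lemma poly_expand (R : nzRingType) (p : {poly R}) : p = \sum_(i < size p) p`_i *: 'X^i.
Proof. by rewrite -[LHS]coefK poly_def. Qed.

Section MomentForm.
Variables (F : numClosedFieldType) (N : nat) (M : nat -> 'M[F]_N.+1).
Local Notation mx := ('M[F]_N.+1).
Implicit Types (p q r : {poly mx}) (A : mx).

Definition moment_form p q : mx :=
  \sum_(i < size p) \sum_(j < size q) p`_i *m M (i + j) *m (q`_j) ^t*.

Lemma form_widen a b p q : (size p <= a)%N -> (size q <= b)%N ->
  moment_form p q = \sum_(i < a) \sum_(j < b) p`_i *m M (i + j) *m (q`_j) ^t*.
Proof.
move=> pa qb; rewrite /moment_form.
rewrite (big_ord_widen a (fun i => \sum_(j < size q) p`_i *m M (i + j) *m (q`_j) ^t*) pa).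
rewrite big_mkcond; apply: eq_bigr => i _; case: ltnP => ip; last first.
  by rewrite big1// => j _; rewrite nth_default// !mul0mx.
rewrite (big_ord_widen b (fun j => p`_i *m M (i + j) *m (q`_j) ^t*) qb).
rewrite big_mkcond; apply: eq_bigr => j _; case: ltnP => // jq.
by rewrite [q`_j]nth_default// trmx0 map_mx0 mulmx0.
Qed.

Lemma formDl p p' q : moment_form (p + p') q = moment_form p q + moment_form p' q.
Proof.
pose a := maxn (size p) (size p').
rewrite !(@form_widen a (size q)) ?leq_maxl ?leq_maxr// ?size_polyD//.
rewrite -big_split; apply: eq_bigr => i _; rewrite -big_split; apply: eq_bigr => j _.
by rewrite /= coefD !mulmxDl.
Qed.

Lemma formDr p q q' : moment_form p (q + q') = moment_form p q + moment_form p q'.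
Proof.
pose a := maxn (size q) (size q').
rewrite !(@form_widen (size p) a) ?leq_maxl ?leq_maxr// ?size_polyD//.
rewrite -big_split; apply: eq_bigr => i _; rewrite -big_split; apply: eq_bigr => j _.
by rewrite /= coefD linearD map_mxD mulmxDr.
Qed.

Lemma formZl A p q : moment_form (A *: p) q = A *m moment_form p q.
Proof.
rewrite (@form_widen (size p) (size q)) ?size_scale_leq// mulmx_sumr.
apply: eq_bigr => i _; rewrite mulmx_sumr; apply: eq_bigr => j _.
by rewrite coefZ -!mulmxA.
Qed.

Lemma formZr A p q : moment_form p (A *: q) = moment_form p q *m A ^t*.
Proof.
rewrite (@form_widen (size p) (size q)) ?size_scale_leq// mulmx_suml.
apply: eq_bigr => i _; rewrite mulmx_suml; apply: eq_bigr => j _.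
by rewrite coefZ -[_ * _]/(_ *m _) trmx_mul map_mxM !mulmxA.
Qed.

Lemma form0l q : moment_form 0 q = 0. Proof. by rewrite /moment_form size_poly0 big_ord0. Qed.

Lemma form0r p : moment_form p 0 = 0.
Proof. by rewrite /moment_form size_poly0 big1// => i _; rewrite big_ord0. Qed.

Lemma formNl p q : moment_form (- p) q = - moment_form p q.
Proof. by apply/eqP; rewrite -addr_eq0 -formDl addNr form0l. Qed.

Lemma formNr p q : moment_form p (- q) = - moment_form p q.
Proof. by apply/eqP; rewrite -addr_eq0 -formDr addNr form0r. Qed.

Lemma formMnl p q n : moment_form (p *+ n) q = moment_form p q *+ n.
Proof. by elim: n => [|n IH]; rewrite ?mulr0n ?form0l// !mulrS formDl IH. Qed.

Lemma formMnr p q n : moment_form p (q *+ n) = moment_form p q *+ n.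
Proof. by elim: n => [|n IH]; rewrite ?mulr0n ?form0r// !mulrS formDr IH. Qed.

Lemma form_suml (I : Type) (s : seq I) (f : I -> {poly mx}) q :
  moment_form (\sum_(i <- s) f i) q = \sum_(i <- s) moment_form (f i) q.
Proof. by elim: s => [|i s IH]; rewrite ?big_nil ?form0l// !big_cons formDl IH. Qed.

Lemma form_sumr (I : Type) (s : seq I) (f : I -> {poly mx}) p :
  moment_form p (\sum_(i <- s) f i) = \sum_(i <- s) moment_form p (f i).
Proof. by elim: s => [|i s IH]; rewrite ?big_nil ?form0r// !big_cons formDr IH. Qed.

Lemma formXn i j : moment_form 'X^i 'X^j = M (i + j).
Proof.
rewrite /moment_form !size_polyXn (bigD1 ord_max)//= [X in _ + X]big1 ?addr0 => [|a ai].
  rewrite (bigD1 ord_max)//= big1 ?addr0 => [|b bj].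
    by rewrite !coefXn !eqxx -[1%:R]/(1%:M) mul1mx trmx1 map_mx1 mulmx1.
  rewrite [X in _ *m X ^t*]coefXn (_ : (b == j :> nat) = false) ?trmx0 ?map_mx0 ?mulmx0//.
  by apply/negbTE; rewrite -val_eqE in bj.
rewrite big1// => b _; rewrite coefXn (_ : (a == i :> nat) = false) ?mul0mx//.
by apply/negbTE; rewrite -val_eqE in ai.
Qed.

Section Eigen.
Variables (P : nat -> {poly mx}) (H : nat -> mx).
Hypothesis sizeP : forall n, size (P n) = n.+1.
Hypothesis monicP : forall n, P n \is monic.
Hypothesis orthP : forall n m, moment_form (P n) (P m) = if n == m then H n else 0.
Hypothesis regH : forall n A, A *m H n = 0 -> A = 0.

Lemma size_sub_lead p m : size p = m.+1 -> (size (p - lead_coef p *: P m)%R <= m)%N.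
Proof.
move=> sp; apply/leq_sizeP => j; rewrite leq_eqVlt => /orP[/eqP <-|mj].
  have := monicP m; rewrite monicE /lead_coef sizeP sp /= => /eqP h.
  by rewrite coefB coefZ h mulr1 subrr.
by rewrite coefB coefZ !nth_default ?mulr0 ?subrr ?sizeP ?sp.
Qed.

(** The leading term of [q] is removed by a left multiple of the monic [P m] of the same degree, and
    the remainder is handled by induction on the size. *)
Lemma form_orth_r n q : (size q <= n)%N -> moment_form (P n) q = 0.
Proof.
have [s] := ubnP (size q); elim: s q => // s IH q; rewrite ltnS => qs qn.
case sq: (size q) => [|m].
  by move/eqP: sq; rewrite size_poly_eq0 => /eqP ->; rewrite form0r.
have h := size_sub_lead sq.
rewrite -(subrK (lead_coef q *: P m) q) formDr formZr orthP.
rewrite gtn_eqF ?mul0mx ?addr0; last by rewrite -sq.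
by apply: IH; [rewrite (leq_ltn_trans h)// -sq|rewrite (leq_trans h)// ltnW// -sq].
Qed.

Lemma form_orth_l n q : (size q <= n)%N -> moment_form q (P n) = 0.
Proof.
have [s] := ubnP (size q); elim: s q => // s IH q; rewrite ltnS => qs qn.
case sq: (size q) => [|m].
  by move/eqP: sq; rewrite size_poly_eq0 => /eqP ->; rewrite form0l.
have h := size_sub_lead sq.
rewrite -(subrK (lead_coef q *: P m) q) formDl formZl orthP.
rewrite ltn_eqF ?mulmx0 ?addr0; last by rewrite -sq.
by apply: IH; [rewrite (leq_ltn_trans h)// -sq|rewrite (leq_trans h)// ltnW// -sq].
Qed.

Variables (T : {poly mx} -> {poly mx}) (Lam : nat -> mx).
Hypothesis T_expand : forall p, T p = \sum_(i < size p) p`_i *: T 'X^i.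
Hypothesis sizeT : forall i, (size (T 'X^i) <= i.+1)%N.
Hypothesis leadT : forall i, (T 'X^i)`_i = Lam i.
Hypothesis symT : forall i j, moment_form (T 'X^i) 'X^j = moment_form 'X^i (T 'X^j).

Lemma formT p q : moment_form (T p) q = moment_form p (T q).
Proof.
rewrite T_expand (T_expand q) [in LHS](poly_expand q) [in RHS](poly_expand p).
rewrite !form_suml; apply: eq_bigr => i _; rewrite !form_sumr; apply: eq_bigr => j _.
by rewrite !formZl !formZr symT.
Qed.

Lemma sizeT_leq p : (size (T p) <= size p)%N.
Proof.
rewrite T_expand; apply: (leq_trans (size_sum _ _ _)); apply/bigmax_leqP => i _.
by rewrite (leq_trans (size_scale_leq _ _))// (leq_trans (sizeT _)).
Qed.

Lemma eigen_of_symmetric n : T (P n) = Lam n *: P n.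
Proof.
pose r := T (P n) - Lam n *: P n.
suff : r = 0 by move/eqP; rewrite subr_eq0 => /eqP.
have size_r : (size r <= n)%N.
  apply/leq_sizeP => j; rewrite leq_eqVlt => /orP[/eqP <-|nj].
    have := monicP n; rewrite monicE /lead_coef sizeP /= => /eqP h.
    rewrite coefB coefZ h mulr1 T_expand coef_sum sizeP big_ord_recr /= h scale1r leadT.
    rewrite big1 ?add0r ?subrr// => i _.
    by rewrite coefZ [(T _)`_n]nth_default ?mulr0// (leq_trans (sizeT _)).
  by rewrite coefB coefZ !nth_default ?mulr0 ?subrr ?sizeP// (leq_trans (sizeT_leq _))// sizeP.
have form_r q : (size q <= n)%N -> moment_form r q = 0.
  move=> qn; rewrite formDl formNl formZl formT !form_orth_r// ?mulmx0 ?subrr//.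
  exact: leq_trans (sizeT_leq _) qn.
(* If r has degree m < n, subtracting its leading coefficient times [P m] leaves a polynomial
   orthogonal to [P m]. Pairing r with [P m] thus gives [lead_coef r *m H m = 0], and regularity of
   [H m] contradicts the nonzero leading coefficient. *)
apply/eqP; rewrite -size_poly_eq0; case sr: (size r) => [//|m].
have mn : (m < n)%N by rewrite -sr.
have := form_r (P m); rewrite sizeP => /(_ mn).
rewrite -(subrK (lead_coef r *: P m) r) formDl formZl orthP eqxx.
rewrite form_orth_l ?size_sub_lead// add0r => /regH /eqP.
by rewrite lead_coef_eq0 -size_poly_eq0 sr.
Qed.

End Eigen.

End MomentForm.

(** * Right action of the operators on monomials *)

Section RightAction.
Variables (F : numFieldType) (N : nat).
Local Notation mx := ('M[F]_N.+1).
Implicit Types (p : {poly mx}) (A : mx) (D : diffop F N).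

(** Coefficients of the operator multiply on the right, so the action commutes with left
    multiplication by matrices and is determined by its values on monomials. *)
Lemma ract_sumZ D (I : Type) (s : seq I) (A : I -> mx) (p : I -> {poly mx}) :
  ract (\sum_(i <- s) A i *: p i) D = \sum_(i <- s) A i *: ract (p i) D.
Proof.
elim: s => [|i s IH].
  by rewrite !big_nil /ract derivnS derivn1 /= !deriv0 !mul0r !addr0.
rewrite !big_cons -IH /ract !derivnS !derivn0 /= !derivD !derivZ !mulrDl -!scalerAl !scalerDr.
by rewrite [X in X + _ = _]addrACA [LHS]addrACA.
Qed.

Lemma ract_expand D p : ract p D = \sum_(i < size p) p`_i *: ract 'X^i D.
Proof. by rewrite [in LHS](poly_expand p) ract_sumZ. Qed.

Let XnC i A : 'X^i * A%:P = A *: 'X^i.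
Proof. by rewrite -mul_polyC; apply/esym; exact: commr_polyXn. Qed.

Lemma ract_opD_Xn (nu : F) i : ract 'X^i (opD N nu) =
  ('X^(i.-2) - 'X^i) *+ (i * i.-1) + (matC F N *: 'X^(i.-1)) *+ i
  - ((N%:R + 2 * nu + 1)%:M *: 'X^i) *+ i - matV F N *: 'X^i.
Proof.
rewrite /ract /opD /= derivXn derivMn derivXn -mulrnA mulrN XnC -scaleNr scaleNr; congr (_ - _).
rewrite -[RHS]addrA; congr (_ + _).
  rewrite mulrnAl mulnC; case: i => [|[|i]]; rewrite ?mul0n ?muln0 ?mulr0n//.
  by rewrite mulrBr mulr1 -exprD addn2.
case: i => [|i]; first by rewrite !mulr0n mul0r subrr.
by rewrite mulrnAl -mulrnBl; congr (_ *+ _); rewrite mulrBr mulrA -exprSr /= !XnC.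
Qed.

Lemma ract_opE_Xn (nu : F) i : ract 'X^i (opE N nu) =
  (matB1 F N *: 'X^i + matB0 F N *: 'X^(i.-1)) *+ i + matA0 N nu *: 'X^i.
Proof.
rewrite /ract /opE /= derivXn mulr0 add0r XnC; congr (_ + _).
case: i => [|i]; first by rewrite !mulr0n mul0r.
by rewrite mulrnAl; congr (_ *+ _); rewrite mulrDr mulrA -exprSr /= !XnC.
Qed.

End RightAction.

Section Symmetry.
Variables (R : realType) (N : nat) (nu : R).
Hypotheses (nu_gt0 : 0 < nu) (N_gt0 : (0 < N)%N).

Local Notation M := (moment (N := N) nu (fun i j => wpoly N nu i j)).
Local Notation C := (matC R N).
Local Notation B0 := (matB0 R N).
Local Notation B1 := (matB1 R N).
Local Notation V := (matV R N).
Local Notation A0 := (matA0 N nu).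
Local Notation c := (N%:R + 2 * nu + 1).

(** With k = i + j, one has i (i - 1) - j (j - 1) = (i - j) (k - 1), and 2 (i Z - j W) = (i - j) (Z
    + W) + k (Z - W) for the terms Z = C M_(k-1) and W = M_(k-1) C^T. The first parts are governed
    by [moment_add], the last by [moment_sub]. *)
Lemma moment_symD i j :
  (M (i.-2 + j) - M (i + j)) *+ (i * i.-1) + (C *m M (i.-1 + j)) *+ i
    - (c%:M *m M (i + j)) *+ i - V *m M (i + j) =
  (M (i + j.-2) - M (i + j)) *+ (j * j.-1) + (M (i + j.-1) *m C^T) *+ j
    - (M (i + j) *m c%:M) *+ j - M (i + j) *m V.
Proof.
have e1 : M (i.-2 + j) *+ (i * i.-1) = M (i + j).-2 *+ (i * i.-1).
  by case: i => [|[|i]]; rewrite ?muln0 ?mulr0n.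
have e2 : M (i + j.-2) *+ (j * j.-1) = M (i + j).-2 *+ (j * j.-1).
  by case: j {e1} => [|[|j]]; rewrite ?muln0 ?mulr0n// !addnS.
have e3 : (C *m M (i.-1 + j)) *+ i = (C *m M (i + j).-1) *+ i.
  by case: i {e1 e2} => [|i]; rewrite ?mulr0n.
have e4 : (M (i + j.-1) *m C^T) *+ j = (M (i + j).-1 *m C^T) *+ j.
  by case: j {e1 e2 e3} => [|j]; rewrite ?mulr0n ?addnS.
rewrite !mulrnBl e1 e2 e3 e4 mul_scalar_mx mul_mx_scalar.
have s2 k : (k * k.-1)%:R = k%:R * (k%:R - 1) :> R.
  by case: k => [|k]; rewrite ?mul0n ?mul0r// natrM -natr1 addrK.
have b := moment_sub N nu_gt0 (i + j).
(* [moment_add] is wanted at k - 1; the factor k makes the statement hold at k = 0 too, and is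
   cancelled below once k is known to be nonzero. *)
have a : (i + j)%:R *: ((2 * (i + j).-1%:R) *: (M (i + j).-2 - M (i + j)) +
    (C *m M (i + j).-1 + M (i + j).-1 *m C^T) - (2 * c) *: M (i + j)) = 0.
  case: (i + j)%N => [|k]; first by rewrite scale0r.
  by rewrite /= moment_add// scaler0.
move: a b; move: (M (i + j).-2) (M (i + j)) (C *m _) (_ *m C^T) (V *m _) (_ *m V) => X Y Z W U T a b.
apply/matrixP => x y; have ex (A : 'M[R]_N.+1) n : (A *+ n) x y = n%:R * A x y.
  by rewrite mulmxnE mulr_natl.
move/matrixP/(_ x y): a; move/matrixP/(_ x y): b; rewrite !(mxE, ex, s2) => b a.
have n2 : (2 : R) != 0 by rewrite pnatr_eq0.
apply: (mulfI n2); have [k0|k0] := eqVneq (i + j)%N 0%N.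
  move/eqP: k0 b; rewrite addn_eq0 => /andP[/eqP -> /eqP ->] b.
  by apply: (eq_by_sub (d := 0) b); rewrite addn0; ring.
have {}a : 2 * (i + j).-1%:R * (X x y - Y x y) + (Z x y + W x y) - 2 * c * Y x y = 0.
  by apply/eqP; move/eqP: a; rewrite mulf_eq0 pnatr_eq0 (negbTE k0).
have kE : (i + j).-1%:R = i%:R + j%:R - 1 :> R.
  by rewrite -natrD -[in RHS](prednK (n := i + j)) ?lt0n// -natr1 addrK.
rewrite kE in a; rewrite natrD in b.
have ab := congr2 (fun u v => (i%:R - j%:R) * u + v) a b.
by apply: (eq_by_sub ab); ring.
Qed.

(** [moment_skew] replaces the right-hand bracket by minus the left-hand one, so that the factors i
    and j add up to i + j and [moment_half] applies. *)
Lemma moment_symE i j :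
  (B1 *m M (i + j) + B0 *m M (i.-1 + j)) *+ i + A0 *m M (i + j) =
  (M (i + j) *m B1 + M (i + j.-1) *m B0^T) *+ j + M (i + j) *m A0.
Proof.
have e3 : (B0 *m M (i.-1 + j)) *+ i = (B0 *m M (i + j).-1) *+ i.
  by case: i => [|i]; rewrite ?mulr0n.
have e4 : (M (i + j.-1) *m B0^T) *+ j = (M (i + j).-1 *m B0^T) *+ j.
  by case: j {e3} => [|j]; rewrite ?mulr0n ?addnS.
rewrite !mulrnDl e3 e4 -!mulrnDl.
have d := moment_half nu_gt0 N_gt0 (i + j).
have s : (M (i + j) *m B1 + M (i + j).-1 *m B0^T) *+ j = - (B1 *m M (i + j) + B0 *m M (i + j).-1) *+ j.
  case: j {e3 e4 d} => [|j]; rewrite ?mulr0n// addnS /=; congr (_ *+ _).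
  apply/eqP; rewrite -addr_eq0; apply/eqP; rewrite -(moment_skew nu_gt0 N_gt0 (i + j)).
  by rewrite addrC !addrA.
rewrite s; apply/eqP; rewrite -subr_eq0; apply/eqP; rewrite -[RHS]d.
rewrite scaler_nat mulNrn opprD opprK mulrnDr.
by rewrite -!addrA; congr (_ + _); rewrite addrCA.
Qed.

End Symmetry.

(** * Passage from real to complex matrices *)

Section Complexification.
Variables (R : realType) (N : nat).
Local Notation rc := (map_mx (real_complex R)).

Lemma adj_real m n (X : 'M[R]_(m, n)) : (rc X) ^t* = rc X^T.
Proof. by apply/matrixP => i j; rewrite !mxE; exact: conjc_real. Qed.

Let rcE (I : Type) (s : seq I) (c : I -> R) (X : I -> 'M[R]_N.+1) :
  rc (\sum_(i <- s) c i *: X i) = \sum_(i <- s) (c i)%:C *: rc (X i).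
Proof. by rewrite raddf_sum; apply: eq_bigr => i _; rewrite /= map_mxZ. Qed.

Let sum_eq (s : seq nat) (c c' : nat -> R[i]) (X Y : nat -> 'M[R[i]]_N.+1) :
  c =1 c' -> X =1 Y -> \sum_(i <- s) c i *: X i = \sum_(i <- s) c' i *: Y i.
Proof. by move=> h k; apply: eq_bigr => i _; rewrite h k. Qed.

Lemma matC_real : matC R[i] N = rc (matC R N).
Proof.
rewrite /matC map_mxD !rcE; congr (_ + _); apply: sum_eq => i; rewrite ?map_delta_mx//.
- by rewrite rmorphB !rmorph_nat.
- by rewrite rmorph_nat.
Qed.

Lemma matV_real : matV R[i] N = rc (matV R N).
Proof.
rewrite /matV map_mxN rcE; congr (- _); apply: sum_eq => i; rewrite ?map_delta_mx//.
by rewrite rmorphM rmorphB !rmorph_nat.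
Qed.

Lemma matB0_real : matB0 R[i] N = rc (matB0 R N).
Proof.
rewrite /matB0 map_mxZ map_mxB !rcE fmorphV rmorph_nat; congr (_ *: (_ - _));
  apply: sum_eq => i; rewrite ?map_delta_mx//.
- by rewrite rmorphB !rmorph_nat.
- by rewrite rmorph_nat.
Qed.

Let ell_real : ell R[i] N = (ell R N)%:C.
Proof. by rewrite /ell fmorph_div !rmorph_nat. Qed.

Lemma matB1_real : matB1 R[i] N = rc (matB1 R N).
Proof.
rewrite /matB1 map_mxZ map_mxN rcE fmorphV ell_real; congr (_ *: - _).
apply: sum_eq => i; rewrite ?map_delta_mx//.
by rewrite rmorphB rmorph_nat.
Qed.

Lemma matA0_real nu : matA0 N nu%:C = rc (matA0 N nu).
Proof.
rewrite /matA0 map_mxZ rcE fmorphV ell_real; congr (_ *: _).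
apply: sum_eq => i; rewrite ?map_delta_mx//.
by rewrite !(rmorphB, rmorphM, rmorphD, rmorph_nat, rmorph1).
Qed.

Lemma map_mxMn (X : 'M[R]_N.+1) n : rc (X *+ n) = rc X *+ n.
Proof. exact: raddfMn. Qed.

Lemma posdefmx_reg n (H A : 'M[R[i]]_n) : posdefmx H -> A *m H = 0 -> A = 0.
Proof.
move=> [_ Hpos] AH; apply/row_matrixP => i; rewrite row0; apply/eqP; apply: contraT => ri.
by have := Hpos _ ri; rewrite -row_mul AH row0 mul0mx mxE ltxx.
Qed.

End Complexification.

Section Main.
Variables (R : realType) (N : nat) (nu : R).
Hypotheses (nu_gt0 : 0 < nu) (N_gt0 : (0 < N)%N).
Local Notation rc := (map_mx (real_complex R)).
Local Notation M := (moment (N := N) nu (fun i j => wpoly N nu i j)).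
Local Notation "<< p , q >>" := (moment_form (fun k => rc (M k)) p q).

Let V_tr : (matV R N)^T = matV R N.
Proof. by rewrite /matV sum_diag linearN /= tr_diag_mx. Qed.

Let B1_tr : (matB1 R N)^T = matB1 R N.
Proof. by rewrite /matB1 sum_diag linearZ linearN /= tr_diag_mx. Qed.

Let A0_tr : (matA0 N nu)^T = matA0 N nu.
Proof. by rewrite /matA0 sum_diag linearZ /= tr_diag_mx. Qed.

Lemma form_symD i j : <<ract 'X^i (opD N nu%:C), 'X^j>> = <<'X^i, ract 'X^j (opD N nu%:C)>>.
Proof.
have cE : (N%:R + 2 * nu%:C + 1)%:M = rc (N%:R + 2 * nu + 1)%:M :> 'M[R[i]]_N.+1.
  by rewrite map_scalar_mx !(rmorphD, rmorphM, rmorph_nat, rmorph1).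
rewrite !ract_opD_Xn matC_real matV_real cE.
rewrite !(formDl, formNl, formMnl, formZl, formXn, formDr, formNr, formMnr, formZr).
rewrite !adj_real tr_scalar_mx V_tr.
move: (moment_symD N nu_gt0 i j).
move: (moment nu _) (matC R N) (matV R N) (_%:M : 'M[R]_N.+1) => M' C V c /(congr1 rc).
by rewrite !(map_mxB, map_mxD, map_mxMn, map_mxM).
Qed.

Lemma form_symE i j : <<ract 'X^i (opE N nu%:C), 'X^j>> = <<'X^i, ract 'X^j (opE N nu%:C)>>.
Proof.
rewrite !ract_opE_Xn matB1_real matB0_real matA0_real.
rewrite !(formDl, formNl, formMnl, formZl, formXn, formDr, formNr, formMnr, formZr).
rewrite !adj_real B1_tr A0_tr.
move: (moment_symE nu_gt0 N_gt0 i j).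
move: (moment nu _) (matB0 R N) (matB1 R N) (matA0 N nu) => M' B0 B1 A0 /(congr1 rc).
by rewrite !(map_mxB, map_mxD, map_mxMn, map_mxM).
Qed.

Lemma size_ract_opD i : (size (ract 'X^i (opD N nu%:C)) <= i.+1)%N.
Proof.
apply/leq_sizeP => k ik; rewrite ract_opD_Xn !(coefB, coefD, coefMn, coefZ, coefXn).
have [e1 e2 e3] : [/\ (k == i) = false, (k == i.-1) = false & (k == i.-2) = false].
  by split; apply/eqP; lia.
by rewrite ?e1 ?e2 ?e3 !(mulr0, mul0rn, subr0, addr0).
Qed.

Lemma size_ract_opE i : (size (ract 'X^i (opE N nu%:C)) <= i.+1)%N.
Proof.
apply/leq_sizeP => k ik; rewrite ract_opE_Xn !(coefB, coefD, coefMn, coefZ, coefXn).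
have [e1 e2 e3] : [/\ (k == i) = false, (k == i.-1) = false & (k == i.-2) = false].
  by split; apply/eqP; lia.
by rewrite ?e1 ?e2 ?e3 !(mulr0, mul0rn, subr0, addr0).
Qed.

(** The second-order and first-order parts contribute i (i - 1) + i (N + 2 nu + 1) = i (N + 2 nu +
    i), with a minus sign. *)
Lemma lead_ract_opD i : (ract 'X^i (opD N nu%:C))`_i = LambdaD N nu%:C i.
Proof.
rewrite ract_opD_Xn !(coefB, coefD, coefMn, coefZ, coefXn) eqxx !mulr1 /LambdaD.
congr (_ - _); case: i => [|i]; first by rewrite !mulr0n !mul0r !oppr0 !addr0 raddf0.
have [e1 e2] : (i.+1 == i.+1.-1) = false /\ (i.+1 == i.+1.-2) = false by split; apply/eqP; lia.
rewrite e1 e2 mulr0 mul0rn addr0 sub0r -[true%:R]/(1%:M) -scalemx1.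
have eM (x : R[i]) k : x%:M *+ k = (x *+ k)%:M :> 'M[R[i]]_N.+1 by rewrite raddfMn.
have -> : - (1 *: 1%:M) = (-1)%:M :> 'M[R[i]]_N.+1 by rewrite scale1r raddfN.
have eB (x y : R[i]) : x%:M - y%:M = (x - y)%:M :> 'M[R[i]]_N.+1 by rewrite raddfB.
rewrite !eM eB; congr (_%:M).
rewrite -(mulr_natr (-1)) natrM /= -(mulr_natr (_ + 1)) -!natr1; ring.
Qed.

Lemma lead_ract_opE i : (ract 'X^i (opE N nu%:C))`_i = LambdaE N nu%:C i.
Proof.
rewrite ract_opE_Xn !(coefD, coefMn, coefZ, coefXn) eqxx !mulr1 /LambdaE addrC scaler_nat.
case: i => [|i]; first by rewrite !mulr0n.
by rewrite gtn_eqF ?mulr0 ?addr0//.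
Qed.

End Main.

Theorem theorem3p2 (R : realType) (N : nat) (nu : R)
    (P : nat -> {poly 'M[R[i]]_N.+1}) :
  (0 < N)%N -> 0 < nu -> monic_mv_gegenbauer nu P ->
  forall n : nat,
    ract (P n) (opD N nu%:C) = (LambdaD N nu%:C n)%:P * P n /\
    ract (P n) (opE N nu%:C) = (LambdaE N nu%:C n)%:P * P n.
Proof.
move=> N_gt0 nu_gt0 [Pmonic [H [Hpos Porth]]] n.
pose M k := map_mx (real_complex R) (moment nu (fun i j : 'I_N.+1 => wpoly N nu i j) k).
have orthP i j : moment_form M (P i) (P j) = if i == j then H i else 0.
  by rewrite -Porth (mxpairingE nu_gt0 (weightE nu_gt0)).
rewrite !mul_polyC; split.
- apply: (@eigen_of_symmetric _ _ M P H _ _ orthP _ (fun p => ract p (opD N nu%:C)) (LambdaD N nu%:C)).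
  + by move=> k; have [] := Pmonic k.
  + by move=> k; have [] := Pmonic k.
  + by move=> k A; apply: posdefmx_reg.
  + exact: ract_expand.
  + exact: size_ract_opD.
  + exact: lead_ract_opD.
  + exact: form_symD.
- apply: (@eigen_of_symmetric _ _ M P H _ _ orthP _ (fun p => ract p (opE N nu%:C)) (LambdaE N nu%:C)).
  + by move=> k; have [] := Pmonic k.
  + by move=> k; have [] := Pmonic k.
  + by move=> k A; apply: posdefmx_reg.
  + exact: ract_expand.
  + exact: size_ract_opE.
  + exact: lead_ract_opE.
  + exact: form_symE.
Qed.
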